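(* Let $m\in\mathbb N\setminus\{0\}$, $p\in\mathbb N$, $n\geqslant 2$. Assume that: (1) $f$ is bounded on $I$; (2) for every $j\in\{1,\dots,m\}$, $\varphi_j'\in\mathcal S_{j+p}$; (3) for every $j\in\{1,\dots,m\}$, $b(\underline a)\varphi_j(\underline a)=b(\overline a)\varphi_j(\overline a)$, where $\underline a=\inf(I)$ and $\overline a=\sup(I)$; (4) (stability at level $m+p$) $\mathfrak L(m+p)<\infty$ and $\mathfrak L(m+p)(\|\Psi_{m+p}^{-1}\|_{\rm op}\vee1)\leqslant\frac{\mathfrak c}{2}\cdot\frac{n}{\log(n)}$, where $\mathfrak c=(3\log(3/2)-1)/9$; (5) $\mathbb E[b'(X_1)^4]<\infty$ and $\mathbb E(Y_1^4)<\infty$. Then $$\begin{aligned}\mathbb E\left[\|\widetilde b_m^{\prime,2}-b'\|_n^2\right]\leqslant{}&2\|f\|_\infty\inf_{t\in\mathcal S_m}\|t-b'\|^2+6\|\Delta_{m,m+p}^{f,2}\|_{\rm op}^2\|b-b_{m+p}\|_f^2+\frac{2\sigma^2}{n}\|\Delta_{m,m+p}^{f,2}\|_F^2\\&+\left[\frac{2\mathfrak c n}{\log(n)}\|\Delta_{m,m+p}\|_{\rm op}^2\,\mathbb E(Y_1^4)^{1/2}+3\,\mathbb E(b'(X_1)^4)^{1/2}\right]\frac{\mathfrak c_{8.1}^{1/2}}{n^4},\end{aligned}$$ with $\Delta_{m,m+p}^{f,2}:=\Psi_{m+p}^{-1/2}\Delta_{m,m+p}^*\Psi_m^{1/2}$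.
   Context: Model: $Y_i=b(X_i)+\varepsilon_i$, $i=1,\dots,n$, where $b$ is an unknown continuously differentiable function, $X_1,\dots,X_n$ are i.i.d. real random variables with density $f$ with respect to Lebesgue measure, and $\varepsilon_1,\dots,\varepsilon_n$ are i.i.d., centered, with variance $\sigma^2$, and independent of $X_1,\dots,X_n$. $I\subseteq\mathbb R$ is an interval and $(\varphi_j)_{j\geqslant 1}$ is a Hilbert (orthonormal) basis of $\mathbb L^2(I,dx)$ made of differentiable functions, extended by $0$ outside $I$. $\mathcal S_m={\rm span}\{\varphi_1,\dots,\varphi_m\}$. Estimation takes place on $I$: $b$ and $b'$ stand for $b\mathbf 1_I$ and $b'\mathbf 1_I$, and $b,b'$ are square integrable on $I$. $b_{m+p}$ is the $\mathbb L^2(I,dx)$-orthogonal projection of $b$ on $\mathcal S_{m+p}$. Boundary values at an infinite endpoint of $I$ are understood as limits. Norms: $\|\cdot\|$ is the norm of $\mathbb L^2(I,dx)$; $\langle\varphi,\psi\rangle_f=\int_I\varphi\psi f\,dx$ with norm $\|\cdot\|_f$; $\|\psi\|_n^2=\frac1n\sum_{i=1}^n\psi(X_i)^2$; $\|f\|_\infty=\sup_I f$; $\|M\|_{\rm op}^2=\lambda_{\max}(MM^* )$, $\|M\|_F^2={\rm Tr}(MM^* )$, with $M^*$ the transpose of $M$. Matrices: $\widehat\Phi_m=(\varphi_j(X_i))_{1\leqslant i\leqslant n,1\leqslant j\leqslant m}$, $\widehat\Psi_m=\frac1n\widehat\Phi_m^*\widehat\Phi_m$, $\Psi_m=\mathbb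 E(\widehat\Psi_m)=(\langle\varphi_j,\varphi_k\rangle_f)_{1\leqslant j,k\leqslant m}$, $\mathfrak L(m)=\sup_{x\in I}\sum_{j=1}^m\varphi_j(x)^2$, $\mathbf Y=(Y_1,\dots,Y_n)^*$. The operator norm of the inverse of a singular matrix is $+\infty$. $\Delta_{m,m+p}$ is the $m\times(m+p)$ matrix with $\varphi_j'=\sum_{k=1}^{m+p}[\Delta_{m,m+p}]_{j,k}\varphi_k$, $j=1,\dots,m$. Estimator: $\widehat b_m^{\prime,2}(x)=\sum_{j=1}^m[\widehat\theta_m^2]_j\varphi_j(x)$ with $\widehat\theta_m^2=-\frac1n\Delta_{m,m+p}\widehat\Psi_{m+p}^{-1}\widehat\Phi_{m+p}^*\mathbf Y$; its truncated version is $\widetilde b_m^{\prime,2}=\widehat b_m^{\prime,2}\mathbf 1_{\Lambda_{m+p}}$, where $\Lambda_m=\{\mathfrak L(m)(\|\widehat\Psi_m^{-1}\|_{\rm op}\vee1)\leqslant\mathfrak c\,n/\log(n)\}$. Constant: $\mathfrak c_{8.1}>0$ is a deterministic constant, not depending on $m$ and $n$, such that whenever $\mathfrak L(m)(\|\Psi_m^{-1}\|_{\rm op}\vee1)\leqslant\frac{\mathfrak c}{2}\frac{n}{\log n}$ one has $\mathbb P(\Omega_m^c)\leqslant\mathfrak c_{8.1}/n^8$ and $\mathbb P(\Lambda_m^c)\leqslant\mathfrak c_{8.1}/n^8$, where $\Omega_m=\{|\|t\|_n^2/\|t\|_f^2-1|\leqslant\frac12,\ \forall t\in\mathcal S_m\}$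 (such a constant exists by a known result of Comte and Genon-Catalot). *)

(* Defs.v *)
From HB Require Import structures.
From mathcomp Require Import all_boot all_order all_algebra.
From mathcomp Require Import all_classical all_reals all_analysis.

Set Implicit Arguments.
Unset Strict Implicit.
Unset Printing Implicit Defensive.

Import Order.TTheory GRing.Theory Num.Theory.
Import numFieldNormedType.Exports.

Local Open Scope classical_set_scope.
Local Open Scope ring_scope.

Definition mutually_independent d (T : measurableType d) (R : realType)
    (P : probability T R) (n : nat) (X : 'I_n -> T -> R) : Prop :=
  forall (J : {set 'I_n}) (A : 'I_n -> set R), (forall i, measurable (A i)) ->
    P (\bigcap_(i in [set` J]) (X i @^-1` A i)) =
    (\prod_(i in J) P (X i @^-1` A i))%E.

Definition sigma_of d (T : measurableType d) (R : realType) (n : nat)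
    (X : 'I_n -> T -> R) : set (set T) :=
  <<s \bigcup_(i in [set: 'I_n]) preimage_set_system setT (X i) measurable >>.

Definition independent_families d (T : measurableType d) (R : realType)
    (P : probability T R) (n k : nat) (X : 'I_n -> T -> R)
    (Z : 'I_k -> T -> R) : Prop :=
  forall A B, sigma_of X A -> sigma_of Z B -> P (A `&` B) = (P A * P B)%E.

Definition iid_with_density d (T : measurableType d) (R : realType)
    (P : probability T R) (f : R -> R) (n : nat)
    (X : 'I_n -> {RV P >-> R}) : Prop :=
  [/\ measurable_fun setT f /\ (forall x, 0 <= f x),
      mutually_independent P (fun i => X i : T -> R) &
      forall i (A : set R), measurable A ->
        distribution P (X i) A = (\int[lebesgue_measure]_(x in A) (f x)%:E)%E].

Definition iid_noise d (T : measurableType d) (R : realType)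
    (P : probability T R) (sigma : R) (n : nat)
    (eps : 'I_n -> {RV P >-> R}) : Prop :=
  [/\ mutually_independent P (fun i => eps i : T -> R),
      (forall i j (A : set R), measurable A ->
         distribution P (eps i) A = distribution P (eps j) A),
      (forall i, 'E_P[eps i]%E = 0%E) &
      (forall i, 'V_P[eps i]%E = (sigma ^+ 2)%:E)].

(* [g \_ D] is g extended by 0 outside D. *)
Definition L2on (R : realType) (I : interval R) (g : R -> R) : Prop :=
  g \_ [set` I] \in Lfun (@lebesgue_measure R) 2%:E.

Definition dotI (R : realType) (I : interval R) (g h : R -> R) : R :=
  \int[@lebesgue_measure R]_(x in [set` I]) (g x * h x).

Definition sqnormI (R : realType) (I : interval R) (g : R -> R) : R :=
  dotI I g g.

Definition dotf (R : realType) (I : interval R) (f g h : R -> R) : R :=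
  \int[@lebesgue_measure R]_(x in [set` I]) (g x * h x * f x).

Definition sqnormf (R : realType) (I : interval R) (f g : R -> R) : R :=
  dotf I f g g.

Definition sqnormn (R : realType) (n : nat) (x : 'I_n -> R) (g : R -> R) : R :=
  n%:R^-1 * \sum_(i < n) g (x i) ^+ 2.

Definition supI (R : realType) (I : interval R) (f : R -> R) : R :=
  sup [set f x | x in [set` I]].

(* Difference quotients are taken inside I, so that the derivative is one-sided
   at an endpoint belonging to I. *)
Definition diffquotI (R : realType) (I : interval R) (g : R -> R) (x : R) :
    set_system R :=
  ((g y - g x) / (y - x)) @[y --> within [set` I] x^'].

Definition derivableI (R : realType) (I : interval R) (g : R -> R) : Prop :=
  forall x, x \in I -> cvg (diffquotI I g x).

Definition deriveI (R : realType) (I : interval R) (g : R -> R) : R -> R :=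
  (fun x => lim (diffquotI I g x)) \_ [set` I].

(* The value of g at inf I (resp. sup I): the actual value if the endpoint
   belongs to I, and the limit from inside I otherwise.  In [Interval l r],
   [BSide true] as l and [BSide false] as r are closed finite endpoints. *)
Definition value_at_inf (R : realType) (I : interval R) (g : R -> R) (v : R) :
    Prop :=
  let: Interval l _ := I in
  match l with
  | BSide true a => g a = v
  | BSide false a => g x @[x --> a^'+] --> v
  | BInfty _ => g x @[x --> -oo] --> v
  end.

Definition value_at_sup (R : realType) (I : interval R) (g : R -> R) (v : R) :
    Prop :=
  let: Interval _ r := I in
  match r with
  | BSide false a => g a = v
  | BSide true a => g x @[x --> a^'-] --> v
  | BInfty _ => g x @[x --> +oo] --> v
  end.

(* Bases are indexed from 0: the function usually written phi_j, j >= 1, is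
   [phi j.-1]. *)
Definition linspan (R : realType) (phi : nat -> R -> R) (m : nat) :
    set (R -> R) :=
  [set t : R -> R | exists c : 'I_m -> R,
     forall x, t x = \sum_(j < m) c j * phi j x].

Definition hilbert_basis (R : realType) (I : interval R) (phi : nat -> R -> R) :
    Prop :=
  [/\ forall j, L2on I (phi j),
      forall j k, dotI I (phi j) (phi k) = (j == k)%:R &
      forall g, L2on I g -> forall e, 0 < e ->
        exists m t, linspan phi m t /\ sqnormI I (g \- t) < e].

Definition orthogonal_projection (R : realType) (I : interval R)
    (phi : nat -> R -> R) (m : nat) (g h : R -> R) : Prop :=
  linspan phi m h /\ forall t, linspan phi m t -> dotI I (g \- h) t = 0.

Definition frakL (R : realType) (I : interval R) (phi : nat -> R -> R)
    (m : nat) : \bar R :=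
  ereal_sup [set (\sum_(j < m) phi j x ^+ 2)%:E | x in [set` I]].

Definition lambda_max (R : realType) (k : nat) (M : 'M[R]_k) : R :=
  sup [set a | eigenvalue M a].

Definition opnorm (R : realType) (k l : nat) (M : 'M[R]_(k, l)) : R :=
  Num.sqrt (lambda_max (M *m M^T)).

Definition sqfrobenius (R : realType) (k l : nat) (M : 'M[R]_(k, l)) : R :=
  \tr (M *m M^T).

Definition opnorm_inv (R : realType) (k : nat) (M : 'M[R]_k) : \bar R :=
  if M \in unitmx then (opnorm (invmx M))%:E else +oo%E.

Definition possemidef (R : realType) (k : nat) (S : 'M[R]_k) : Prop :=
  S^T = S /\ forall v : 'rV[R]_k, 0 <= (v *m S *m v^T) 0 0.

(* A positive semidefinite matrix has exactly one such square root. *)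
Definition sqrtmx (R : realType) (k : nat) (M : 'M[R]_k) : 'M[R]_k :=
  xget 0 [set S | possemidef S /\ S *m S = M].

Definition hatPhi (R : realType) (phi : nat -> R -> R) (n m : nat)
    (x : 'I_n -> R) : 'M[R]_(n, m) := \matrix_(i, j) phi j (x i).

Definition hatPsi (R : realType) (phi : nat -> R -> R) (n m : nat)
    (x : 'I_n -> R) : 'M[R]_m :=
  n%:R^-1 *: ((hatPhi phi m x)^T *m hatPhi phi m x).

Definition Psi (R : realType) (I : interval R) (phi : nat -> R -> R)
    (f : R -> R) (m : nat) : 'M[R]_m :=
  \matrix_(j, k) dotf I f (phi j) (phi k).

Definition Deltaf2 (R : realType) (I : interval R) (phi : nat -> R -> R)
    (f : R -> R) (m p : nat) (Delta : 'M[R]_(m, m + p)) : 'M[R]_(m + p, m) :=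
  invmx (sqrtmx (Psi I phi f (m + p))) *m Delta^T *m sqrtmx (Psi I phi f m).

Definition frakc (R : realType) : R := (3 * ln (3 / 2) - 1) / 9.

Definition stability (R : realType) (I : interval R) (phi : nat -> R -> R)
    (m : nat) (M : 'M[R]_m) (bound : R) : Prop :=
  (frakL I phi m * maxe (opnorm_inv M) 1 <= bound%:E)%E.

Definition Lambda d (T : measurableType d) (R : realType)
    (P : probability T R) (I : interval R) (phi : nat -> R -> R) (n m : nat)
    (X : 'I_n -> {RV P >-> R}) : set T :=
  [set w | stability I phi (hatPsi phi m (fun i => X i w))
             (frakc R * n%:R / ln n%:R)].

(* The ratio of norms is meaningless for ||t||_f = 0. *)
Definition Omega d (T : measurableType d) (R : realType)
    (P : probability T R) (I : interval R) (phi : nat -> R -> R) (f : R -> R)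
    (n m : nat) (X : 'I_n -> {RV P >-> R}) : set T :=
  [set w | forall t, linspan phi m t -> sqnormf I f t != 0 ->
     `|sqnormn (fun i => X i w) t / sqnormf I f t - 1| <= 2^-1].

(* The constant may depend on I, on the basis and on f, but neither on n and m
   nor on the probability space carrying the sample. *)
Definition deviation_constant (R : realType) (I : interval R)
    (phi : nat -> R -> R) (f : R -> R) (c : R) : Prop :=
  0 < c /\
  forall (d : measure_display) (T : measurableType d) (P : probability T R)
    (n m : nat) (X : 'I_n -> {RV P >-> R}),
    (2 <= n)%N -> (0 < m)%N -> iid_with_density f X ->
    stability I phi (Psi I phi f m) (frakc R / 2 * (n%:R / ln n%:R)) ->
    (P (~` Omega I phi f m X) <= (c / n%:R ^+ 8)%:E)%E /\
    (P (~` Lambda I phi m X) <= (c / n%:R ^+ 8)%:E)%E.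

Definition hattheta (R : realType) (phi : nat -> R -> R) (n m p : nat)
    (Delta : 'M[R]_(m, m + p)) (x : 'I_n -> R) (y : 'cV[R]_n) : 'cV[R]_m :=
  - (n%:R^-1 *: (Delta *m invmx (hatPsi phi (m + p) x)
                   *m (hatPhi phi (m + p) x)^T *m y)).

Definition hatb (R : realType) (phi : nat -> R -> R) (n m p : nat)
    (Delta : 'M[R]_(m, m + p)) (x : 'I_n -> R) (y : 'cV[R]_n) : R -> R :=
  fun z => \sum_(j < m) hattheta phi Delta x y j 0 * phi j z.

Definition response d (T : measurableType d) (R : realType)
    (P : probability T R) (b : R -> R) (n : nat)
    (X eps : 'I_n -> {RV P >-> R}) (w : T) : 'cV[R]_n :=
  \col_i (b (X i w) + eps i w).

Definition tildeb d (T : measurableType d) (R : realType)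
    (P : probability T R) (I : interval R) (phi : nat -> R -> R) (b : R -> R)
    (n m p : nat) (Delta : 'M[R]_(m, m + p)) (X eps : 'I_n -> {RV P >-> R})
    (w : T) : R -> R :=
  fun z => hatb phi Delta (fun i => X i w) (response b X eps w) z *
           \1_(Lambda I phi (m + p) X) w.

(* Main.v *)
(* Write N = m + p and let [Lambda], [Omega] be the events of the deviation bound
   at level N.  Integration by parts and the boundary condition show that the
   projection of b' on S_m has coefficients - Delta theta, where theta are those
   of the projection b_N of b on S_N.  Since least squares reproduce b_N exactly,
   on [Lambda] the vector of values of the estimator minus b' at the sample is
   (b'_m - b')(X) - A (r + eps) with r = (b - b_N)(X) and A a function of X only.

   On [Lambda] and [Omega] the two norms on S_N are equivalent, so
   |A r|^2 <= 3 |D|^2 |r|^2.  By independence the noise contributes exactly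
   sigma^2 E tr(A A^T).  To get the constant 2 (and not 3) in front of its bound,
   only Psi_N <= 2 hatPsi_N is used pathwise: it gives
   tr(A A^T) <= 2 tr(hatPsi_m Delta Psi_N^-1 Delta^T), whose expectation is
   2 tr(D D^T) because E hatPsi_m = Psi_m.  Off [Omega] but on [Lambda], stability
   bounds the empirical norm of the estimator by that of Y, and off [Lambda] the
   estimator vanishes; both events are handled by Cauchy-Schwarz.

   [Lambda] and [Omega] are measurable because each says that some quadratic forms
   are nonnegative, which can be tested on rational vectors. *)
Require Import Defs.
From HB Require Import structures.
From mathcomp Require Import all_boot all_order all_algebra.
From mathcomp Require Import all_classical all_reals all_analysis.
From mathcomp Require Import measurable_realfun ring lra.

Set Implicit Arguments.
Unset Strict Implicit.
Unset Printing Implicit Defensive.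

Import Order.TTheory GRing.Theory Num.Theory.
Import numFieldNormedType.Exports.

Local Open Scope classical_set_scope.
Local Open Scope ring_scope.

(** * Quadratic forms and least squares *)

Section linear_algebra.
Variable R : realType.

(** The indicator of [Good] is multiplied into the signal and into the noise weights before any
    expectation is taken. Both then stay functions of the sample alone and the weights are bounded,
    so the squared error expands with vanishing cross terms. The inequality (u - v)^2 <= 2 u^2 + 2
    v^2 is therefore spent on the bias only: it gives the constants 2 and 6 = 2 * 3, where 3 = 2 *
    3/2 combines the two sides of the comparison defining [Omega].

    The coefficient 3 of the moment of b' is 2 + 1: off [Omega] the estimator and b' are separated
    at the price of a factor 2, whereas off [Lambda] the error is b' itself.

    Sample points may fall outside I, where b need not vanish. The basis does vanish there, so those
    responses do not enter the estimator, and b can be replaced by its restriction to I. *)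

Definition bilf k (S : 'M[R]_k) (u v : 'rV[R]_k) : R := (u *m S *m v^T) 0 0.
Definition qf k (S : 'M[R]_k) (v : 'rV[R]_k) : R := bilf S v v.
Definition sqn k (v : 'rV[R]_k) : R := (v *m v^T) 0 0.

Lemma sqnE k (v : 'rV[R]_k) : sqn v = \sum_j v 0 j ^+ 2.
Proof. by rewrite /sqn mxE; apply: eq_bigr => j _; rewrite mxE expr2. Qed.

Lemma sqn_ge0 k (v : 'rV[R]_k) : 0 <= sqn v.
Proof. by rewrite sqnE; apply: sumr_ge0 => j _; exact: sqr_ge0. Qed.

Lemma sqn_eq0 k (v : 'rV[R]_k) : sqn v = 0 -> v = 0.
Proof.
rewrite sqnE => /eqP; rewrite psumr_eq0; last by move=> j _; exact: sqr_ge0.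
move=> /allP h; apply/rowP => j; rewrite mxE.
by have := h j (mem_index_enum _); rewrite sqrf_eq0 => /eqP.
Qed.

Lemma bilfDl k (S : 'M[R]_k) u v w : bilf S (u + v) w = bilf S u w + bilf S v w.
Proof. by rewrite /bilf !mulmxDl mxE. Qed.

Lemma bilfZl k (S : 'M[R]_k) a u w : bilf S (a *: u) w = a * bilf S u w.
Proof. by rewrite /bilf -!scalemxAl mxE. Qed.

Lemma bilfC k (S : 'M[R]_k) u w : bilf S u w = bilf S^T w u.
Proof.
rewrite /bilf -[u *m S *m w^T]trmxK [LHS]mxE.
by rewrite !trmx_mul trmxK mulmxA.
Qed.

Lemma bilfDr k (S : 'M[R]_k) u v w : bilf S w (u + v) = bilf S w u + bilf S w v.
Proof. by rewrite ![bilf S w _]bilfC bilfDl. Qed.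

Lemma bilfZr k (S : 'M[R]_k) a u w : bilf S w (a *: u) = a * bilf S w u.
Proof. by rewrite ![bilf S w _]bilfC bilfZl. Qed.

Lemma qfZ k (S : 'M[R]_k) a u : qf S (a *: u) = a ^+ 2 * qf S u.
Proof. by rewrite /qf bilfZl bilfZr mulrA. Qed.

Lemma sqn_qf1 k (v : 'rV[R]_k) : sqn v = qf 1%:M v.
Proof. by rewrite /sqn /qf /bilf mulmx1. Qed.

Lemma sqnZ k a (v : 'rV[R]_k) : sqn (a *: v) = a ^+ 2 * sqn v.
Proof. by rewrite !sqn_qf1 qfZ. Qed.

Lemma qfB k (S S' : 'M[R]_k) v : qf (S - S') v = qf S v - qf S' v.
Proof. by rewrite /qf /bilf mulmxBr mulmxBl mxE [in X in _ + X]mxE. Qed.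

Lemma qf_scalar k (a : R) (v : 'rV[R]_k) : qf a%:M v = a * sqn v.
Proof. by rewrite /qf /bilf /sqn mul_mx_scalar -scalemxAl mxE. Qed.

Lemma sqn_mulmx k l (M : 'M[R]_(k, l)) v : sqn (v *m M) = qf (M *m M^T) v.
Proof. by rewrite /sqn /qf /bilf trmx_mul !mulmxA. Qed.

Lemma possemidef1 k : possemidef (1%:M : 'M[R]_k).
Proof.
by split; [rewrite trmx1|move=> v; rewrite mulmx1; exact: sqn_ge0].
Qed.

Lemma possemidef_gram k l (M : 'M[R]_(k, l)) : possemidef (M *m M^T).
Proof.
split; first by rewrite trmx_mul trmxK.
by move=> v; have := sqn_ge0 (v *m M); rewrite sqn_mulmx.
Qed.

(** Evaluate at the minimiser t = - b / c when c > 0. The same lemma serves for quadratic forms and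
    for integrals. *)
Lemma discriminant_le (a b c : R) :
  0 <= a -> 0 <= c -> (forall t, 0 <= a + 2 * t * b + t ^+ 2 * c) ->
  b ^+ 2 <= a * c.
Proof.
move=> a0 c0 h.
have [cz|cn] := eqVneq c 0.
  have [->|bn] := eqVneq b 0; first by rewrite expr0n /= cz mulr0.
  (* With c = 0 the polynomial is affine; this root of a + 2 t b = -1 contradicts nonnegativity. *)
  have := h (- (a + 1) / (2 * b)); rewrite cz.
  have -> : a + 2 * (- (a + 1) / (2 * b)) * b + (- (a + 1) / (2 * b)) ^+ 2 * 0 = -1.
    by field.
  lra.
have cp : 0 < c by rewrite lt_def cn.
have := h (- b / c).
have -> : a + 2 * (- b / c) * b + (- b / c) ^+ 2 * c = (a * c - b ^+ 2) / c by field.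
by rewrite pmulr_lge0 ?invr_gt0 // subr_ge0.
Qed.

Lemma psd_cauchy_schwarz k (S : 'M[R]_k) u v : possemidef S ->
  bilf S u v ^+ 2 <= qf S u * qf S v.
Proof.
move=> [Ss Sp]; apply: discriminant_le => [||t]; [exact: Sp..|].
have := Sp (u + t *: v); rewrite -/(bilf _ _ _) bilfDl !bilfDr !bilfZl !bilfZr.
have -> : bilf S v u = bilf S u v by rewrite bilfC Ss.
by rewrite /qf => h; apply: le_trans h _; rewrite le_eqVlt; apply/orP; left; apply/eqP; ring.
Qed.

(** Cauchy-Schwarz for the form S between [v] and [v *m S]: their mixed value is [sqn (v *m S)]. *)
Lemma psd_qf0 k (S : 'M[R]_k) v : possemidef S -> qf S v = 0 -> v *m S = 0.
Proof.
move=> pS h; apply: sqn_eq0.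
have := psd_cauchy_schwarz v (v *m S) pS; rewrite h mul0r => h1.
have /eqP := le_anti (introT andP (conj h1 (sqr_ge0 _))).
by rewrite sqrf_eq0 => /eqP.
Qed.

Lemma cauchy_schwarz_sqn k (u v : 'rV[R]_k) :
  ((u *m v^T) 0 0) ^+ 2 <= sqn u * sqn v.
Proof.
have := psd_cauchy_schwarz u v (possemidef1 k).
by rewrite /bilf mulmx1 -!sqn_qf1.
Qed.

Lemma qf_continuous k (S : 'M[R]_k) : continuous (qf S).
Proof.
have -> : qf S = fun v : 'rV[R]_k => \sum_j (\sum_i v 0 i * S i j) * v 0 j.
  by apply/funext => v; rewrite /qf /bilf mxE; apply: eq_bigr => j _; rewrite !mxE.
have sumc (F : 'I_k -> 'rV[R]_k -> R) : (forall i, continuous (F i)) ->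
    continuous (fun v => \sum_i F i v).
  move=> cF; apply: (@continuous_big R _ +%R 0 xpredT) => [|i _]; last exact: cF.
  exact: add_continuous.
have lin j : continuous (fun v : 'rV[R]_k => \sum_i v 0 i * S i j).
  apply: (sumc (fun i v => v 0 i * S i j)) => i v.
  by apply: (@continuousM R 'rV[R]_k (fun v => v 0 i) (cst (S i j)));
    [exact: coord_continuous|exact: cst_continuous].
apply: (sumc (fun j v => (\sum_i v 0 i * S i j) * v 0 j)) => j v.
apply: (@continuousM R 'rV[R]_k (fun v => \sum_i v 0 i * S i j) (fun v => v 0 j)).
  exact: lin.
exact: coord_continuous.
Qed.

Lemma sqn_continuous k : continuous (@sqn k).
Proof.
have -> : @sqn k = qf 1%:M by apply/funext => v; exact: sqn_qf1.
exact: qf_continuous.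
Qed.

Lemma sphere_compact k : compact [set v : 'rV[R]_k | sqn v = 1].
Proof.
apply: bounded_closed_compact; last first.
  have /= := @preimage_closed 'rV[R]_k R (@sqn k) [set 1].
  by apply => // v _; exact: sqn_continuous.
exists 1; split => //= M M1 v /= v1; apply: le_trans (ltW M1).
rewrite [leLHS]/Num.norm /= mx_normrE; apply/bigmax_leP; split => // -[i j] _ /=.
rewrite (ord1 i) -ler_sqr ?nnegrE // expr1n real_normK ?num_real // -v1 sqnE.
rewrite (bigD1 j) //= lerDl; apply: sumr_ge0 => ? _; exact: sqr_ge0.
Qed.

(* The eigenvector maximises the quadratic form on the unit sphere. *)
Lemma top_eigenvector k (S : 'M[R]_k.+1) : S^T = S ->
  exists a v, [/\ sqn v = 1, v *m S = a *: v &
    forall u, qf S u <= a * sqn u].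
Proof.
move=> Ss.
have [||c] := @EVT_max_rV _ _ (qf S) _ _ (@sphere_compact k.+1).
- exists (delta_mx 0 0) => /=; rewrite sqnE (bigD1 0) //= big1 => [|j /negbTE j0].
    by rewrite mxE !eqxx addr0 expr1n.
  by rewrite mxE j0 expr0n.
- by apply: continuous_subspaceT => v; exact: qf_continuous.
rewrite inE /= => c1 cmax.
have main u : qf S u <= qf S c * sqn u.
  have [u0|un] := eqVneq (sqn u) 0.
    by rewrite u0 (sqn_eq0 u0) /qf /bilf !mul0mx mxE mulr0.
  have up : 0 < sqn u by rewrite lt_def un sqn_ge0.
  have := cmax ((Num.sqrt (sqn u))^-1 *: u).
  rewrite inE /= sqnZ qfZ exprVn sqr_sqrtr ?sqn_ge0// mulVf // => /(_ erefl).
  by rewrite mulrC ler_pdivrMr.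
exists (qf S c), c; split => //.
(* The maximiser is an eigenvector because this positive semidefinite form vanishes at it, hence so
   does its image. *)
have ps : possemidef ((qf S c)%:M - S).
  split; first by rewrite linearB /= Ss tr_scalar_mx.
  by move=> v; rewrite -/(bilf _ _ _) -/(qf _ _) qfB qf_scalar subr_ge0.
have := psd_qf0 (v := c) ps; rewrite qfB qf_scalar c1 mulr1 subrr => /(_ erefl).
by rewrite mulmxBr mul_mx_scalar => /eqP; rewrite subr_eq0 => /eqP.
Qed.

(** The top eigenvalue belongs to the spectrum and bounds it, so the [sup] is a genuine one. In
    dimension 0 the spectrum is empty and both sides are 0. *)
Lemma qf_le_lambda_max k (S : 'M[R]_k) (v : 'rV[R]_k) : S^T = S ->
  qf S v <= lambda_max S * sqn v.
Proof.
case: k S v => [|k] S v Ss.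
  by rewrite (thinmx0 v) /sqn /qf /bilf !mul0mx !mxE mulr0.
have [a [w [w1 wS amax]]] := top_eigenvector Ss.
apply: le_trans (amax v) _; apply: ler_wpM2r; first exact: sqn_ge0.
apply: ub_le_sup; last first.
  apply/eigenvalueP; exists w => //; apply/eqP => w0.
  by move: w1; rewrite w0 /sqn mul0mx mxE => /esym/eqP; rewrite oner_eq0.
exists a => b /= /eigenvalueP[u uS un].
have up : 0 < sqn u by rewrite lt_def sqn_ge0 andbT; apply: contra_neq un => /sqn_eq0.
have := amax u; rewrite /qf /bilf uS -scalemxAl mxE -/(sqn u).
by rewrite ler_pM2r.
Qed.

Lemma lambda_max_le k (S : 'M[R]_k) K : 0 <= K ->
  (forall v, qf S v <= K * sqn v) -> lambda_max S <= K.
Proof.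
move=> K0 h; rewrite /lambda_max.
have [->|/set0P ne] := eqVneq [set a | eigenvalue S a] set0; first by rewrite sup0.
apply: ge_sup => // b /= /eigenvalueP[u uS un].
have up : 0 < sqn u by rewrite lt_def sqn_ge0 andbT; apply: contra_neq un => /sqn_eq0.
have := h u; rewrite /qf /bilf uS -scalemxAl mxE -/(sqn u).
by rewrite ler_pM2r.
Qed.

Lemma lambda_max_ge0 k (S : 'M[R]_k) : possemidef S -> 0 <= lambda_max S.
Proof.
move=> [Ss Sp]; case: k S Ss Sp => [|k] S Ss Sp.
  rewrite /lambda_max; set A := [set _ | _].
  have -> : A = set0.
    apply/seteqP; split => // a /eigenvalueP[u _]; by rewrite (thinmx0 u) eqxx.
  by rewrite sup0.
pose e : 'rV[R]_k.+1 := delta_mx 0 0.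
have e1 : sqn e = 1.
  rewrite sqnE (bigD1 0) //= big1 => [|j /negbTE j0].
    by rewrite mxE !eqxx addr0 expr1n.
  by rewrite mxE j0 expr0n.
by have := le_trans (Sp e) (qf_le_lambda_max e Ss); rewrite e1 mulr1.
Qed.

Lemma sqr_opnorm k l (M : 'M[R]_(k, l)) : opnorm M ^+ 2 = lambda_max (M *m M^T).
Proof. by rewrite sqr_sqrtr// lambda_max_ge0//; exact: possemidef_gram. Qed.

Lemma opnorm_ge0 k l (M : 'M[R]_(k, l)) : 0 <= opnorm M.
Proof. exact: sqrtr_ge0. Qed.

Lemma sqn_le_opnorm k l (M : 'M[R]_(k, l)) v : sqn (v *m M) <= opnorm M ^+ 2 * sqn v.
Proof.
rewrite sqn_mulmx sqr_opnorm; apply: qf_le_lambda_max.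
by case: (possemidef_gram M).
Qed.

(** [opnorm] is defined through M M^T and bounds v M directly. For the transpose, write the squared
    norm of v M^T as the inner product of v with v M^T M, apply Cauchy-Schwarz and cancel one
    factor. *)
Lemma sqn_le_opnorm_tr k l (M : 'M[R]_(k, l)) v :
  sqn (v *m M^T) <= opnorm M ^+ 2 * sqn v.
Proof.
have [h0|hn] := eqVneq (sqn (v *m M^T)) 0.
  by rewrite h0 mulr_ge0 ?sqr_ge0 ?sqn_ge0.
have hp : 0 < sqn (v *m M^T) by rewrite lt_def hn sqn_ge0.
have := cauchy_schwarz_sqn v (v *m M^T *m M).
rewrite !trmx_mul trmxK !mulmxA.
have -> : (v *m M^T *m M *m v^T) 0 0 = sqn (v *m M^T).
  by rewrite /sqn trmx_mul trmxK !mulmxA.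
move=> /le_trans /(_ (ler_wpM2l (sqn_ge0 v) (sqn_le_opnorm M (v *m M^T)))).
by rewrite expr2 mulrA ler_pM2r // mulrC.
Qed.

Lemma opnorm_le k l (M : 'M[R]_(k, l)) K : 0 <= K ->
  (forall v, sqn (v *m M) <= K ^+ 2 * sqn v) -> opnorm M <= K.
Proof.
move=> K0 h; rewrite -(ler_sqr (opnorm_ge0 M)) // sqr_opnorm.
by apply: lambda_max_le => [|v]; rewrite ?sqr_ge0// -sqn_mulmx.
Qed.

(* Cauchy-Schwarz for the form defined by [B], whose values are at most
   [opnorm B] times the squared norm. *)
Lemma psd_sqn_le k (B : 'M[R]_k) z : possemidef B ->
  sqn (z *m B) <= opnorm B * qf B z.
Proof.
move=> pB; have [Bs Bp] := pB.
have [h0|hn] := eqVneq (sqn (z *m B)) 0.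
  by rewrite h0 mulr_ge0 ?opnorm_ge0 //; exact: Bp.
have hp : 0 < sqn (z *m B) by rewrite lt_def hn sqn_ge0.
have qle u : qf B u <= opnorm B * sqn u.
  rewrite -ler_sqr ?nnegrE ?mulr_ge0 ?opnorm_ge0 ?sqn_ge0 //; last exact: Bp.
  apply: le_trans (cauchy_schwarz_sqn (u *m B) u) _.
  rewrite exprMn (expr2 (sqn u)) mulrA; apply: ler_wpM2r; first exact: sqn_ge0.
  exact: sqn_le_opnorm.
have := psd_cauchy_schwarz z (z *m B) pB.
have -> : bilf B z (z *m B) = sqn (z *m B) by [].
move=> /le_trans /(_ (ler_wpM2l (Bp z) (qle _))).
by rewrite expr2 mulrA ler_pM2r // mulrC.
Qed.

(* Deflation: with [v] a unit top eigenvector, [S - a v^T v] is again positive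
   semidefinite, kills [v], and has smaller rank. *)
Lemma possemidef_sqrt k (S : 'M[R]_k) : possemidef S ->
  exists Q, possemidef Q /\ Q *m Q = S.
Proof.
have [n] := ubnP (\rank S); elim: n k S => // n IH [|k] S rS pS.
  exists 0; split; last by rewrite (flatmx0 S) mul0mx; exact: flatmx0.
  by split=> [|v]; rewrite ?trmx0 // mulmx0 mul0mx mxE.
have [a [v [v1 vS amax]]] := top_eigenvector pS.1.
have qv : qf S v = a by rewrite /qf /bilf vS -scalemxAl mxE -/(sqn v) v1 mulr1.
have a0 : 0 <= a by rewrite -qv; exact: pS.2.
have [az|an] := eqVneq a 0.
  have S0 : S = 0.
    apply/row_matrixP => i; rewrite row0 rowE; apply: psd_qf0 => //.
    apply/eqP; rewrite eq_le; apply/andP; split; last exact: pS.2.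
    by have := amax (delta_mx 0 i); rewrite az mul0r.
  exists 0; split; last by rewrite S0 mul0mx.
  by split=> [|u]; rewrite ?trmx0 // mulmx0 mul0mx mxE.
pose S' := S - a *: (v^T *m v).
have vv : v *m v^T = 1%:M.
  by apply/matrixP => i j; rewrite !ord1 [RHS]mxE eqxx mulr1n -v1.
have vS' : v *m S' = 0.
  by rewrite mulmxBr vS -scalemxAr mulmxA vv mul1mx subrr.
have S's : S'^T = S' by rewrite linearB /= linearZ /= trmx_mul trmxK pS.1.
have S'v : S' *m v^T = 0.
  by apply: trmx_inj; rewrite trmx_mul trmxK S's vS' trmx0.
have pS' : possemidef S'.
  (* [y] is the component of [x] orthogonal to [v]: the deflated form at [x] is the form S at
     [y]. *)
  split=> // x; pose y := x - ((x *m v^T) 0 0) *: v.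
  suff -> : (x *m S' *m x^T) 0 0 = (y *m S *m y^T) 0 0 by exact: pS.2.
  have yS : y *m S = x *m S'.
    rewrite /y mulmxBl -scalemxAl vS mulmxBr -scalemxAr mulmxA.
    have := mx11_scalar (x *m v^T); move: ((x *m v^T) 0 0) => c ->.
    by rewrite mul_scalar_mx !scalerA mulrC.
  have -> : y^T = x^T - (x *m v^T) 0 0 *: v^T by rewrite /y linearB /= linearZ.
  rewrite yS (mulmxBr (x *m S') x^T) -(scalemxAr _ (x *m S')) -(mulmxA x S' v^T) S'v.
  by rewrite mulmx0 scaler0 subr0.
have S'S : (S' <= S)%MS.
  have -> : S' = (1%:M - v^T *m v) *m S.
    by rewrite mulmxBl mul1mx -mulmxA vS -scalemxAr.
  exact: submxMl.
(* The row space loses [v]: it lies in that of S because a is nonzero, but not in that of S', which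
   is orthogonal to [v]. *)
have rS' : (\rank S' < n)%N.
  rewrite ltnS in rS; apply: leq_trans rS; apply: rank_ltmx.
  rewrite ltmxE S'S /=; apply/negP => SS'.
  have vS1 : (v <= S')%MS.
    apply: submx_trans SS'; rewrite -[v](scalerK an) -vS scalemx_sub //.
    exact: submxMl.
  have [x vx] := submxP vS1.
  have := vv; rewrite {1}vx -mulmxA S'v mulmx0 => /matrixP/(_ 0 0)/eqP.
  by rewrite !mxE eqxx eq_sym oner_eq0.
have [Q [pQ QQ]] := IH _ _ rS' pS'.
have vQ : v *m Q = 0.
  by apply: sqn_eq0; rewrite sqn_mulmx pQ.1 QQ /qf /bilf vS' mul0mx mxE.
have Qv : Q *m v^T = 0.
  by apply: trmx_inj; rewrite trmx_mul trmxK pQ.1 vQ trmx0.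
(* The square of this sum has no cross terms, since Q kills [v] on both sides. *)
exists (Q + Num.sqrt a *: (v^T *m v)); split.
  split=> [|x]; first by rewrite linearD /= linearZ /= trmx_mul trmxK pQ.1.
  rewrite mulmxDr mulmxDl mxE addr_ge0 //; first exact: pQ.2.
  rewrite -scalemxAr -scalemxAl mxE mulr_ge0 ?sqrtr_ge0 //.
  have := sqn_ge0 (x *m v^T); rewrite /sqn trmx_mul trmxK.
  by rewrite !mulmxA.
rewrite mulmxDl !mulmxDr QQ -scalemxAr -!scalemxAl [Q *m (v^T *m v)]mulmxA Qv.
rewrite mul0mx scaler0 addr0 -[v^T *m v *m Q]mulmxA vQ mulmx0 scaler0 add0r.
rewrite -scalemxAr scalerA -expr2 sqr_sqrtr // -[v^T *m v *m _]mulmxA.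
by rewrite [v *m (_ *m _)]mulmxA vv mul1mx /S' subrK.
Qed.

Lemma sqrtmxP k (S : 'M[R]_k) : possemidef S ->
  possemidef (sqrtmx S) /\ sqrtmx S *m sqrtmx S = S.
Proof.
by move=> /possemidef_sqrt; exact: xgetPex.
Qed.

Lemma gram_qf n k (F : 'M[R]_(n, k)) v :
  qf (n%:R^-1 *: (F^T *m F)) v = n%:R^-1 * sqn (v *m F^T).
Proof.
by rewrite sqn_mulmx trmxK /qf /bilf -scalemxAr -scalemxAl mxE.
Qed.

Lemma possemidef_scaled_gram n k (F : 'M[R]_(n, k)) :
  possemidef (n%:R^-1 *: (F^T *m F)).
Proof.
split=> [|v]; first by rewrite linearZ /= trmx_mul trmxK.
by have := gram_qf F v; rewrite /qf /bilf => ->; rewrite mulr_ge0 ?invr_ge0 ?ler0n ?sqn_ge0.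
Qed.

Lemma trmx_inv_sym k (H : 'M[R]_k) : H^T = H -> (invmx H)^T = invmx H.
Proof. by move=> Hs; rewrite trmx_inv Hs. Qed.

Lemma qf_invmx k (H : 'M[R]_k) z : H \in unitmx -> H^T = H ->
  qf (invmx H) z = qf H (z *m invmx H).
Proof.
move=> Hu Hs; rewrite /qf /bilf trmx_mul trmx_inv_sym // -!mulmxA.
by rewrite (mulmxA H) mulmxV // mul1mx.
Qed.

Lemma possemidef_invmx k (H : 'M[R]_k) : H \in unitmx -> possemidef H ->
  possemidef (invmx H).
Proof.
move=> Hu [Hs Hp]; split=> [|v]; first exact: trmx_inv_sym.
by rewrite -/(bilf _ _ _) -/(qf _ _) qf_invmx //; exact: Hp.
Qed.

(** Inversion reverses the order of forms. Cauchy-Schwarz for S between z H^-1 and z S^-1 has z H^-1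
    z^T as mixed value; after S <= c H is applied at z H^-1, one factor cancels. *)
Lemma qf_invmx_le k (H S : 'M[R]_k) c z : possemidef H -> possemidef S ->
  H \in unitmx -> S \in unitmx -> 0 <= c ->
  (forall v, qf S v <= c * qf H v) -> qf (invmx H) z <= c * qf (invmx S) z.
Proof.
move=> pH pS Hu Su c0 h.
have qi : 0 <= qf (invmx S) z by apply: (possemidef_invmx Su pS).2.
have [h0|hn] := eqVneq (qf (invmx H) z) 0; first by rewrite h0 mulr_ge0.
have hp : 0 < qf (invmx H) z.
  by rewrite lt_def hn; exact: (possemidef_invmx Hu pH).2.
have := psd_cauchy_schwarz (z *m invmx H) (z *m invmx S) pS.
have -> : bilf S (z *m invmx H) (z *m invmx S) = qf (invmx H) z.
  rewrite /qf /bilf trmx_mul trmx_inv_sym ?(proj1 pS) // -!mulmxA.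
  by rewrite (mulmxA S) mulmxV // mul1mx.
rewrite -(qf_invmx z Su pS.1) => /le_trans /(_ (ler_wpM2r qi (h _))).
rewrite -(qf_invmx z Hu pH.1) expr2 -mulrA (mulrCA c) [leRHS]mulrC.
by rewrite [leRHS]mulrC ler_pM2l.
Qed.

(** * Least squares for a fixed design *)

Definition lsq n k (F : 'M[R]_(n, k)) (y : 'rV[R]_n) : 'rV[R]_k :=
  n%:R^-1 *: (y *m F *m invmx (n%:R^-1 *: (F^T *m F))).

Section least_squares.
Variables (n m k : nat) (F : 'M[R]_(n, k)) (G : 'M[R]_(n, m)).
Variable Delta : 'M[R]_(m, k).
Let H := n%:R^-1 *: (F^T *m F).
Let K := n%:R^-1 *: (G^T *m G).
Hypothesis n_gt0 : (0 < n)%N.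
Hypothesis Hu : H \in unitmx.

Let n_pos : 0 < n%:R^-1 :> R. Proof. by rewrite invr_gt0 ltr0n. Qed.
Let pH : possemidef H. Proof. exact: possemidef_scaled_gram. Qed.

Lemma lsq_mulmx y : lsq F y *m H = n%:R^-1 *: (y *m F).
Proof. by rewrite -scalemxAl mulmxKV. Qed.

Lemma lsq_fit v : lsq F (v *m F^T) = v.
Proof. by rewrite /lsq -[v *m F^T *m F]mulmxA scalemxAl scalemxAr mulmxK. Qed.

(** Fitting is an orthogonal projection: the inner product of [y] with its fit is the squared norm
    of the fit. *)
Lemma qf_lsq_le y : qf H (lsq F y) <= n%:R^-1 * sqn y.
Proof.
have [h0|hn] := eqVneq (qf H (lsq F y)) 0.
  by rewrite h0 mulr_ge0 ?sqn_ge0 // ltW.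
have hp : 0 < qf H (lsq F y) by rewrite lt_def hn; exact: pH.2.
have := cauchy_schwarz_sqn y (lsq F y *m F^T).
have -> : (y *m (lsq F y *m F^T)^T) 0 0 = n%:R * qf H (lsq F y).
  rewrite [in RHS]/qf /bilf lsq_mulmx trmx_mul trmxK mulmxA -scalemxAl [in RHS]mxE.
  by rewrite mulrA divff ?mul1r // pnatr_eq0 -lt0n.
have -> : sqn (lsq F y *m F^T) = n%:R * qf H (lsq F y).
  by rewrite gram_qf mulrA divff ?mul1r // pnatr_eq0 -lt0n.
rewrite expr2 ler_pM2r; last by rewrite mulr_gt0 ?ltr0n.
by rewrite ler_pdivlMl ?ltr0n.
Qed.

(** Going through the quadratic form of H^-1 costs only the first power of [opnorm (invmx H)], as
    needed for [lsq_estimate_le]. *)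
Lemma sqn_lsq_le y : sqn (lsq F y) <= opnorm (invmx H) * (n%:R^-1 * sqn y).
Proof.
have -> : lsq F y = (n%:R^-1 *: (y *m F)) *m invmx H by rewrite -scalemxAl.
apply: le_trans (psd_sqn_le _ (possemidef_invmx Hu pH)) _.
apply: ler_wpM2l; first exact: opnorm_ge0.
by rewrite (qf_invmx _ Hu pH.1) -scalemxAl; exact: qf_lsq_le.
Qed.

(** The product of [L] and [opnorm (invmx H)] appearing here is what the stability condition
    controls. *)
Lemma lsq_estimate_le L y : 0 <= L -> (forall v, qf K v <= L * sqn v) ->
  n%:R^-1 * sqn (lsq F y *m Delta^T *m G^T) <=
  L * opnorm (invmx H) * opnorm Delta ^+ 2 * (n%:R^-1 * sqn y).
Proof.
move=> L0 h; rewrite -gram_qf; apply: le_trans (h _) _.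
have -> : L * opnorm (invmx H) * opnorm Delta ^+ 2 * (n%:R^-1 * sqn y) =
    L * (opnorm Delta ^+ 2 * (opnorm (invmx H) * (n%:R^-1 * sqn y))) by ring.
apply: ler_wpM2l => //.
apply: le_trans (sqn_le_opnorm_tr _ _) _.
apply: (ler_wpM2l (sqr_ge0 _)).
exact: sqn_lsq_le.
Qed.

Variables (S : 'M[R]_k) (S' : 'M[R]_m).
Hypotheses (Su : S \in unitmx) (pS : possemidef S) (pS' : possemidef S').
Hypothesis SH : forall v, qf S v <= 2 * qf H v.
Let D := invmx (sqrtmx S) *m Delta^T *m sqrtmx S'.

Let Qu : sqrtmx S \in unitmx.
Proof.
have [_ QQ] := sqrtmxP pS.
by move: Su; rewrite -{1}QQ !unitmxE det_mulmx unitrM => /andP[].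
Qed.

(** The constant is 3 = 3/2 * 2: the factor 3/2 replaces K by S', and 2 replaces S by H. In between,
    [D] is [Delta^T] read in coordinates that are orthonormal for S and S'. *)
Lemma lsq_residual_le y : (forall v, qf K v <= 3 / 2 * qf S' v) ->
  n%:R^-1 * sqn (lsq F y *m Delta^T *m G^T) <=
  3 * opnorm D ^+ 2 * (n%:R^-1 * sqn y).
Proof.
move=> h; rewrite -gram_qf; apply: le_trans (h _) _.
have [[Qs _] QQ] := sqrtmxP pS; have [[Qs' _] QQ'] := sqrtmxP pS'.
have -> : qf S' (lsq F y *m Delta^T) = sqn (lsq F y *m sqrtmx S *m D).
  rewrite -{1}QQ' -{2}Qs' -sqn_mulmx /D -!mulmxA (mulmxA (sqrtmx S)) mulmxV //.
  by rewrite mul1mx.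
have := sqn_le_opnorm D (lsq F y *m sqrtmx S).
rewrite [sqn (_ *m sqrtmx S)]sqn_mulmx Qs QQ => h1.
have h2 := le_trans (SH (lsq F y)) (ler_wpM2l (ler0n _ _) (qf_lsq_le y)).
have := ler_wpM2l (sqr_ge0 (opnorm D)) h2; lra.
Qed.

(** With z the i-th row of G Delta, the left side is n^-1 z H^-1 z^T, and S <= 2 H turns into H^-1
    <= 2 S^-1. *)
Lemma lsq_noise_le i :
  sqn (row i (n%:R^-1 *: (F *m invmx H *m Delta^T *m G^T))^T) <=
  2 / n%:R * sqn (row i (G *m (Delta *m invmx (sqrtmx S)))).
Proof.
have [[Qs _] QQ] := sqrtmxP pS.
pose z := row i (G *m Delta).
have -> : row i (n%:R^-1 *: (F *m invmx H *m Delta^T *m G^T))^T =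
    n%:R^-1 *: (z *m invmx H *m F^T).
  rewrite linearZ /= linearZ /= !trmx_mul !trmxK trmx_inv_sym ?pH.1 //.
  by rewrite /z !row_mul !mulmxA.
rewrite sqnZ expr2 -mulrA -gram_qf -(qf_invmx _ Hu pH.1).
have -> : sqn (row i (G *m (Delta *m invmx (sqrtmx S)))) = qf (invmx S) z.
  rewrite mulmxA row_mul -/z sqn_mulmx trmx_inv_sym //; congr qf.
  rewrite -[LHS]mul1mx -(mulVmx Su) -[invmx S *m S *m _]mulmxA -{2}QQ -!mulmxA.
  by rewrite (mulmxA (sqrtmx S) (invmx _)) mulmxV // mul1mx mulmxV // mulmx1.
rewrite mulrAC [leRHS]mulrC; apply: ler_wpM2l; first exact: ltW.
exact: qf_invmx_le.
Qed.

(** Expresses the Frobenius norm through values of the form S', which become squared f-norms of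
    functions once S' is [Psi]. *)
Lemma sqfrobenius_rows :
  sqfrobenius D = \sum_l qf S' (row l (Delta *m invmx (sqrtmx S))^T).
Proof.
have [[Qs _] QQ] := sqrtmxP pS; have [[Qs' _] QQ'] := sqrtmxP pS'.
rewrite /sqfrobenius /mxtrace; apply: eq_bigr => l _.
rewrite -[in RHS]QQ' -[X in qf (_ *m X)]Qs' -sqn_mulmx.
have <- : row l D = row l (Delta *m invmx (sqrtmx S))^T *m sqrtmx S'.
  by rewrite trmx_mul trmx_inv_sym // -row_mul.
by rewrite /sqn !mxE; apply: eq_bigr => j _; rewrite !mxE.
Qed.

End least_squares.
End linear_algebra.

(** * Integration and independence *)

Section measurable_matrices.
Context d (T : measurableType d) (R : realType).

(** Inversion is not continuous at 0; writing 1/y as y times a power of y^2 gives a product of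
    measurable maps that is also 0 at 0. *)
Lemma measurable_fun_invr (f : T -> R) :
  measurable_fun setT f -> measurable_fun setT (fun w => (f w)^-1).
Proof.
move=> mf.
have -> : (fun w => (f w)^-1) = (fun w => f w * ((f w) ^+ 2) `^ (- 1)).
  apply/funext => w; rewrite powR_inv1 ?sqr_ge0 //.
  have [->|fn] := eqVneq (f w) 0; first by rewrite invr0 mul0r.
  by field.
apply: measurable_funM => //.
apply: (@measurableT_comp _ _ _ _ _ _ (fun x : R => x `^ (-1)) _ (fun w => f w ^+ 2)) => //.
exact: measurable_funX.
Qed.

Definition measurable_mx k l (M : T -> 'M[R]_(k, l)) :=
  forall i j, measurable_fun setT (fun w => M w i j).

Lemma measurable_mulmx k l q (M : T -> 'M[R]_(k, l)) (M' : T -> 'M[R]_(l, q)) :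
  measurable_mx M -> measurable_mx M' -> measurable_mx (fun w => M w *m M' w).
Proof.
move=> mM mM' i j; under eq_fun do rewrite mxE.
by apply: measurable_sum => s; apply: measurable_funM; [exact: mM|exact: mM'].
Qed.

Lemma measurable_cst_mx k l (M : 'M[R]_(k, l)) : measurable_mx (cst M).
Proof. by move=> i j; exact: measurable_cst. Qed.

Lemma measurable_trmx k l (M : T -> 'M[R]_(k, l)) :
  measurable_mx M -> measurable_mx (fun w => (M w)^T).
Proof. by move=> mM i j; under eq_fun do rewrite mxE; exact: mM. Qed.

Lemma measurable_scalemx k l (a : R) (M : T -> 'M[R]_(k, l)) :
  measurable_mx M -> measurable_mx (fun w => a *: M w).
Proof.
move=> mM i j; under eq_fun do rewrite mxE.
by apply: measurable_funM => //; exact: mM.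
Qed.

Lemma measurable_addmx k l (M M' : T -> 'M[R]_(k, l)) :
  measurable_mx M -> measurable_mx M' -> measurable_mx (fun w => M w + M' w).
Proof.
move=> mM mM' i j; under eq_fun do rewrite mxE.
by apply: measurable_funD; [exact: mM|exact: mM'].
Qed.

Lemma measurable_det k (M : T -> 'M[R]_k) :
  measurable_mx M -> measurable_fun setT (fun w => \det (M w)).
Proof.
move=> mM; apply: measurable_sum => s; apply: measurable_funM => //.
by apply: measurable_prod => i _; exact: mM.
Qed.

Lemma measurable_invmx k (M : T -> 'M[R]_k) :
  measurable_mx M -> measurable_mx (fun w => invmx (M w)).
Proof.
move=> mM i j.
(* [invmx] returns its argument on singular matrices, hence the second branch. *)
have -> : (fun w => invmx (M w) i j) = fun w =>
    if \det (M w) != 0 then (\det (M w))^-1 * cofactor (M w) j i else M w i j.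
  apply/funext => w; rewrite /invmx unitmxE unitfE.
  by case: ifP => // _; rewrite !mxE.
apply: measurable_fun_ifT.
- apply: measurable_neg; apply: measurable_fun_eqr => //; exact: measurable_det.
- apply: measurable_funM; first exact/measurable_fun_invr/measurable_det.
  apply: measurable_funM => //; apply: measurable_det => a b.
  by under eq_fun do rewrite !mxE; exact: mM.
- exact: mM.
Qed.

Lemma measurable_qf k (M : T -> 'M[R]_k) v :
  measurable_mx M -> measurable_fun setT (fun w => qf (M w) v).
Proof.
move=> mM; apply: measurable_mulmx; last exact: measurable_cst_mx.
by apply: measurable_mulmx => //; exact: measurable_cst_mx.
Qed.

(** A negative value would persist on a neighbourhood, by continuity, and that neighbourhood
    contains a rational vector. *)
Lemma qf_ge0_rat k (S : 'M[R]_k) :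
  (forall c : 'rV[rat]_k, 0 <= qf S (map_mx ratr c)) -> forall v, 0 <= qf S v.
Proof.
move=> h v; rewrite leNgt; apply/negP => qv.
have /nbhs_ballP[e /= e0 he] : nbhs v (qf S @^-1` [set x | x < 0]).
  apply: (@qf_continuous R k S v); exact: lt_nbhsl.
have rx j : exists q : rat, ratr q \in `]v 0 j, v 0 j + e[.
  by apply: rat_in_itvoo; rewrite ltrDl.
pose c : 'rV[rat]_k := \row_j xchoose (rx j).
have : ball v e (map_mx ratr c : 'rV[R]_k).
  split=> // i j; rewrite (ord1 i) !mxE.
  have := xchooseP (rx j); rewrite in_itv /= => /andP[h1 h2].
  by rewrite /ball /= ltr_distlC; apply/andP; split; lra.
by move=> /he /=; rewrite ltNge h.
Qed.

Lemma measurable_psd k (M : T -> 'M[R]_k) :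
  measurable_mx M -> measurable [set w | forall v, 0 <= qf (M w) v].
Proof.
move=> mM.
have -> : [set w | forall v, 0 <= qf (M w) v] =
    ~` \bigcup_(c in [set: 'rV[rat]_k])
       [set w | qf (M w) (map_mx ratr c) < 0].
  apply/seteqP; split => w /= h.
    by move=> [c _ /=]; rewrite ltNge h.
  apply: qf_ge0_rat => c; rewrite leNgt; apply/negP => hc; apply: h.
  by exists c.
apply: measurableC; apply: countable_bigcupT_measurable.
  exact: countableP.
move=> c; have /(_ measurableT [set true]) := measurable_fun_ltr
  (measurable_qf (map_mx ratr c) mM) (measurable_cst (0 : R)).
by rewrite setTI preimage_true; exact.
Qed.

End measurable_matrices.

Section real_integrals.
Context d (T : measurableType d) (R : realType) (mu : {measure set T -> \bar R}).
Variable (D : set T) (mD : measurable D).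
Implicit Types f g h : T -> R.

Lemma integrable_le f g : measurable_fun D f ->
  mu.-integrable D (EFin \o g) -> (forall w, D w -> `|f w| <= g w) ->
  mu.-integrable D (EFin \o f).
Proof.
move=> mf ig fg; apply: (le_integrable _ _ _ ig) => //.
  exact/measurable_EFinP.
by move=> w Dw /=; rewrite lee_fin (le_trans (fg w Dw)) // ler_norm.
Qed.

Lemma integrable_addr f g :
  mu.-integrable D (EFin \o f) -> mu.-integrable D (EFin \o g) ->
  mu.-integrable D (EFin \o (fun w => f w + g w)).
Proof. by move=> i1 i2; exact: (integrableD mD i1 i2). Qed.

Lemma integrable_sqr_mul f g : measurable_fun D f -> measurable_fun D g ->
  mu.-integrable D (EFin \o (fun w => f w ^+ 2)) ->
  mu.-integrable D (EFin \o (fun w => g w ^+ 2)) ->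
  mu.-integrable D (EFin \o (fun w => f w * g w)).
Proof.
move=> mf mg if2 ig2.
apply: (@integrable_le _ (fun w => f w ^+ 2 + g w ^+ 2)).
- exact: measurable_funM.
- exact: integrable_addr.
- move=> w _; rewrite normrM -(real_normK (num_real (f w))).
  rewrite -(real_normK (num_real (g w))).
  have := sqr_ge0 (`|f w| - `|g w|).
  have := mulr_ge0 (normr_ge0 (f w)) (normr_ge0 (g w)); nra.
Qed.

Lemma integrable_mulr_cst f (c : R) :
  mu.-integrable D (EFin \o f) -> mu.-integrable D (EFin \o (fun w => c * f w)).
Proof. by move=> i1; exact: (integrableZl mD c i1). Qed.

Lemma integrable_sumr (J : Type) (s : seq J) (F : J -> T -> R) :
  (forall j, mu.-integrable D (EFin \o F j)) ->
  mu.-integrable D (EFin \o (fun w => \sum_(j <- s) F j w)).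
Proof.
move=> iF; elim: s => [|j s IH].
  under eq_fun do rewrite big_nil; exact: integrable0.
rewrite (_ : (fun _ => _) = fun w => F j w + \sum_(j <- s) F j w); last first.
  by apply/funext => w; rewrite big_cons.
exact: integrable_addr.
Qed.

Lemma Rintegral_sum (J : Type) (s : seq J) (F : J -> T -> R) :
  (forall j, mu.-integrable D (EFin \o F j)) ->
  (\int[mu]_(w in D) \sum_(j <- s) F j w) = \sum_(j <- s) \int[mu]_(w in D) F j w.
Proof.
move=> iF; elim: s => [|j s IH].
  rewrite big_nil; under eq_Rintegral do rewrite big_nil.
  by rewrite /Rintegral integral0.
rewrite big_cons -IH; under eq_Rintegral do rewrite big_cons.
by rewrite RintegralD //; exact: integrable_sumr.
Qed.

Lemma EFin_Rintegral f : mu.-integrable D (EFin \o f) ->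
  (\int[mu]_(w in D) f w)%:E = (\int[mu]_(w in D) (f w)%:E)%E.
Proof.
by move=> i; rewrite /Rintegral fineK //; exact: integrable_fin_num.
Qed.

Lemma ge0_integrable f : measurable_fun D f -> (forall w, D w -> 0 <= f w) ->
  (\int[mu]_(w in D) (f w)%:E < +oo)%E -> mu.-integrable D (EFin \o f).
Proof.
move=> mf f0 fi; apply/integrableP; split; first exact/measurable_EFinP.
rewrite (le_lt_trans _ fi) //; apply: ge0_le_integral => //.
- by apply: measurableT_comp => //; exact/measurable_EFinP.
- exact/measurable_EFinP.
- by move=> w Dw /=; rewrite lee_fin ger0_norm // f0.
Qed.

End real_integrals.

(** * Products of independent variables *)

Section joint_law.
Context d (T : measurableType d) (R : realType) (P : probability T R).
Variables (g h : T -> R).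
Hypotheses (mg : measurable_fun setT g) (mh : measurable_fun setT h).

Let gm : {mfun T >-> R} := HB.pack g (isMeasurableFun.Build _ _ _ _ _ mg).
Let hm : {mfun T >-> R} := HB.pack h (isMeasurableFun.Build _ _ _ _ _ mh).
Let km : {mfun T >-> (R * R)%type} := HB.pack (fun w => (g w, h w))
  (isMeasurableFun.Build _ _ _ _ _ (measurable_fun_pair mg mh)).

(** [mu] and [nu] are left free, so that the pairs (X_j, eps_j) can all be compared with the laws of
    one fixed pair. *)
Lemma integral_joint_law (mu nu : probability R R) :
  (forall A B, measurable A -> measurable B ->
     P (g @^-1` A `&` h @^-1` B) = (mu A * nu B)%E) ->
  forall F : R * R -> \bar R, measurable_fun setT F -> (forall z, 0 <= F z)%E ->
  (\int[P]_w F (g w, h w) = \int[mu \x nu]_z F z)%E.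
Proof.
move=> gh F mF F0.
rewrite -[LHS](@ge0_integral_distribution _ _ _ _ _ P km F) //.
apply: eq_measure_integral => X mX _; apply/esym.
apply: (@product_measure_unique _ _ _ _ _ mu nu (distribution P km)) => //.
Qed.

Hypothesis gh : forall A B, measurable A -> measurable B ->
  P (g @^-1` A `&` h @^-1` B) = (P (g @^-1` A) * P (h @^-1` B))%E.
Hypothesis ig : P.-integrable setT (EFin \o g).
Hypothesis ih : P.-integrable setT (EFin \o h).

Let mu := distribution P gm.
Let nu := distribution P hm.

Let mprod : measurable_fun setT (fun z : R * R => z.1 * z.2).
Proof. by apply: measurable_funM. Qed.

Lemma indep_integrableM : P.-integrable setT (EFin \o (fun w => g w * h w)).
Proof.
apply/integrableP; split; first exact/measurable_EFinP/measurable_funM.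
have mabs : measurable_fun setT (fun y : R => `|y|%:E).
  by apply/measurable_EFinP; exact: normr_measurable.
have mF : measurable_fun setT (fun z : R * R => `|(z.1 * z.2)%:E|%E).
  exact/measurableT_comp/measurable_EFinP.
rewrite (_ : (\int[P]_w _ = \int[P]_w `|((g w, h w).1 * (g w, h w).2)%:E|)%E) //.
rewrite (@integral_joint_law mu nu _ (fun z => `|(z.1 * z.2)%:E|%E)) //.
rewrite fubini_tonelli1 // /fubini_F /=.
under eq_integral => x _.
  under eq_integral => y _ do rewrite normrM EFinM.
  rewrite ge0_integralZl //.
  over.
rewrite /= ge0_integralZr //; last exact: integral_ge0.
have -> : (\int[distribution P hm]_y `|y|%:E = \int[P]_w `|(h w)%:E|)%E.
  by rewrite (@ge0_integral_distribution _ _ _ _ _ P hm (fun y => `|y|%:E)).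
have -> : (\int[distribution P gm]_y `|y|%:E = \int[P]_w `|(g w)%:E|)%E.
  by rewrite (@ge0_integral_distribution _ _ _ _ _ P gm (fun y => `|y|%:E)).
move/integrableP: ig => [_ ig1]; move/integrableP: ih => [_ ih1].
by rewrite lte_mul_pinfty // ?integral_ge0 // ge0_fin_numE // integral_ge0.
Qed.

Lemma indep_RintegralM :
  (\int[P]_w (g w * h w) = (\int[P]_w g w) * (\int[P]_w h w))%R.
Proof.
have mid : measurable_fun setT (EFin : R -> \bar R) by exact/measurable_EFinP.
have igd : (distribution P gm).-integrable setT (EFin : R -> \bar R).
  by apply: (@integrable_pushforward _ _ _ _ _ g mg P setT EFin) => //.
have ihd : (distribution P hm).-integrable setT (EFin : R -> \bar R).
  by apply: (@integrable_pushforward _ _ _ _ _ h mh P setT EFin) => //.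
have Eg : (\int[distribution P gm]_y y%:E = \int[P]_w (g w)%:E)%E.
  by rewrite (@integral_distribution _ _ _ _ _ P gm EFin).
have Eh : (\int[distribution P hm]_y y%:E = \int[P]_w (h w)%:E)%E.
  by rewrite (@integral_distribution _ _ _ _ _ P hm EFin).
have mF : measurable_fun setT (fun z : R * R => (z.1 * z.2)%:E).
  exact/measurable_EFinP.
have rectE X : measurable X -> distribution P km X = (mu \x nu)%E X.
  move=> mX; apply/esym.
  by apply: (@product_measure_unique _ _ _ _ _ mu nu (distribution P km)).
have iF : (mu \x nu)%E.-integrable setT (fun z : R * R => (z.1 * z.2)%:E).
  have := @integrable_pushforward _ _ _ _ _ _ (measurable_fun_pair mg mh) P setT
    (fun z : R * R => (z.1 * z.2)%:E) mF.
  move=> /(_ indep_integrableM measurableT) /integrableP[_ i1].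
  apply/integrableP; split => //.
  rewrite (eq_measure_integral (distribution P km)) // => X mX _.
  by apply/esym; exact: rectE.
apply: EFin_inj.
rewrite EFinM !EFin_Rintegral //; last exact: indep_integrableM.
transitivity (\int[distribution P km]_z (z.1 * z.2)%:E)%E.
  by rewrite (@integral_distribution _ _ _ _ _ P km
    (fun z => (z.1 * z.2)%:E)) //; exact: indep_integrableM.
rewrite (eq_measure_integral (mu \x nu)%E); last by move=> X mX _; exact: rectE.
rewrite -integral12_prod_meas1 // /fubini_F /=.
under eq_integral => x _.
  under eq_integral => y _ do rewrite EFinM.
  rewrite integralZl // Eh.
  over.
rewrite /= -Eg -Eh.
have fh : (\int[distribution P hm]_y y%:E)%E \is a fin_num.
  exact: integrable_fin_num.
by rewrite -(fineK fh) integralZr.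
Qed.

End joint_law.

Section expectations.
Context d (T : measurableType d) (R : realType) (P : probability T R).

(** The law of X is absolutely continuous, and its Radon-Nikodym derivative equals [f] almost
    everywhere because both have the same integral over every measurable set. *)
Lemma integral_density (X : {RV P >-> R}) (f : R -> R) (h : R -> \bar R) :
  measurable_fun setT f -> (forall x, 0 <= f x) ->
  (forall A : set R, measurable A ->
    distribution P X A = (\int[lebesgue_measure]_(x in A) (f x)%:E)%E) ->
  measurable_fun setT h -> (forall x, 0 <= h x)%E ->
  (\int[P]_w h (X w) = \int[lebesgue_measure]_x (h x * (f x)%:E))%E.
Proof.
move=> mf f0 law mh h0.
have mX : measurable_fun setT (X : T -> measurableTypeR R).
  exact: (measurable_funP X).
pose Xm : {mfun T >-> measurableTypeR R} :=
  HB.pack (X : T -> measurableTypeR R) (isMeasurableFun.Build _ _ _ _ _ mX).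
rewrite -[LHS](@ge0_integral_distribution _ _ _ _ _ P Xm h) //.
pose nu : {finite_measure set (measurableTypeR R) -> \bar R} := distribution P Xm.
pose mu : {sigma_finite_measure set (measurableTypeR R) -> \bar R} :=
  @lebesgue_measure R.
have dom : nu `<< mu.
  move=> A nA B mB BA; rewrite /nu /= [LHS]law //; apply: null_set_integral => //.
    exact/measurable_EFinP/measurable_funTS.
  exact: nA.
have ff : measurable_fun setT (EFin \o f) by exact/measurable_EFinP.
rewrite -(Radon_Nikodym_SigmaFinite.change_of_variables dom) //.
have ig := Radon_Nikodym_SigmaFinite.f_integrable dom.
apply: ge0_ae_eq_integral => //.
- by apply: emeasurable_funM => //; exact: measurable_int ig.
- exact: emeasurable_funM.
- by move=> x _; rewrite mule_ge0 // Radon_Nikodym_SigmaFinite.f_ge0.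
- by move=> x _; rewrite mule_ge0 // lee_fin.
- apply: ae_eqe_mul2l; apply: integral_ae_eq => // A _ mA.
  by rewrite -Radon_Nikodym_SigmaFinite.f_integral //; exact: law.
Qed.

(** The discriminant of t -> E (Z + t 1_A)^2, together with 1_A^2 = 1_A. *)
Lemma cauchy_schwarz_indic (Z : T -> R) (A : set T) (q : R) : measurable A ->
  measurable_fun setT Z -> P.-integrable setT (EFin \o (fun w => Z w ^+ 2)) ->
  (P A <= q%:E)%E -> 0 <= q ->
  \int[P]_w (\1_A w * Z w) <=
  Num.sqrt (\int[P]_w (Z w ^+ 2)) * Num.sqrt q.
Proof.
move=> mA mZ iZ2 Aq q0.
have mI : measurable_fun setT (\1_A : T -> R) by exact: measurable_indic.
have iI : P.-integrable setT (EFin \o (\1_A : T -> R)).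
  by apply: integrable_indic; rewrite ?probability_fin_num // ltry.
have I2 w : (\1_A w : R) ^+ 2 = \1_A w.
  by rewrite indicE; case: (_ \in _); rewrite ?expr1n ?expr0n.
have iIZ : P.-integrable setT (EFin \o (fun w => \1_A w * Z w)).
  apply: integrable_sqr_mul => //.
  by under eq_fun do rewrite I2.
have i0 : 0 <= \int[P]_w (Z w ^+ 2).
  by apply: Rintegral_ge0 => w _; exact: sqr_ge0.
apply: le_trans (ler_norm _) _; rewrite -sqrtr_sqr -sqrtrM // ler_wsqrtr //.
have PA : (\int[P]_w \1_A w)%R%:E = P A.
  by rewrite EFin_Rintegral // integral_indic // setIT.
apply: (@le_trans _ _ (\int[P]_w (Z w ^+ 2) * \int[P]_w (\1_A w))); last first.
  by apply: ler_wpM2l => //; rewrite -lee_fin PA.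
apply: discriminant_le => // [|t].
  by apply: Rintegral_ge0 => w _; rewrite indicE.
have -> : \int[P]_w (Z w ^+ 2) + 2 * t * (\int[P]_w (\1_A w * Z w)) +
    t ^+ 2 * (\int[P]_w (\1_A w)) =
    \int[P]_w ((Z w ^+ 2 + (2 * t) * (\1_A w * Z w)) + t ^+ 2 * \1_A w).
  rewrite RintegralD //; [|exact/integrable_addr/integrable_mulr_cst|
    exact: integrable_mulr_cst].
  by rewrite RintegralD ?RintegralZl //; exact: integrable_mulr_cst.
apply: Rintegral_ge0 => w _; rewrite -[X in t ^+ 2 * X]I2.
have -> : Z w ^+ 2 + 2 * t * (\1_A w * Z w) + t ^+ 2 * \1_A w ^+ 2 =
  (Z w + t * \1_A w) ^+ 2 by ring.
exact: sqr_ge0.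
Qed.

(** Taking the square root of the deviation probability turns n^8 into the n^4 of the risk bound. *)
Lemma cauchy_schwarz_deviation (A : set T) (g : T -> R) (n : nat) (c : R) :
  measurable A -> (0 < n)%N -> 0 < c -> (P A <= (c / n%:R ^+ 8)%:E)%E ->
  measurable_fun setT g -> P.-integrable setT (EFin \o (fun w => g w ^+ 4)) ->
  P.-integrable setT (EFin \o (fun w => \1_A w * g w ^+ 2)) /\
  \int[P]_w (\1_A w * g w ^+ 2) <=
    Num.sqrt (\int[P]_w (g w ^+ 4)) * (Num.sqrt c / n%:R ^+ 4).
Proof.
move=> mA n_gt0 c0 PA mg ig4.
have n4 : 0 < n%:R ^+ 4 :> R by rewrite exprn_gt0 // ltr0n.
have sq2 w : (g w ^+ 2) ^+ 2 = g w ^+ 4 by rewrite -exprM.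
have ig : P.-integrable setT (EFin \o (fun w => (g w ^+ 2) ^+ 2)).
  by under eq_fun do rewrite sq2.
have c8 : 0 <= c / n%:R ^+ 8 by rewrite divr_ge0 ?(ltW c0) ?exprn_ge0.
have mg2 : measurable_fun setT (fun w => g w ^+ 2) by exact: measurable_funX.
split.
  have I2 w : (\1_A w : R) ^+ 2 = \1_A w.
    by rewrite indicE; case: (_ \in _); rewrite ?expr1n ?expr0n.
  apply: integrable_sqr_mul => //.
  by under eq_fun do rewrite I2; exact: integrable_indic.
have := cauchy_schwarz_indic mA mg2 ig PA c8.
under [X in _ <= Num.sqrt X * _]eq_Rintegral do rewrite sq2.
have -> : Num.sqrt (c / n%:R ^+ 8) = Num.sqrt c / n%:R ^+ 4; last by [].
rewrite sqrtrM ?(ltW c0) // sqrtrV ?exprn_ge0 //.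
by rewrite (exprM _ 4 2) sqrtr_sqr ger0_norm // ltW.
Qed.

Definition indep2 (g h : T -> R) := forall A B, measurable A -> measurable B ->
  P (g @^-1` A `&` h @^-1` B) = (P (g @^-1` A) * P (h @^-1` B))%E.

Section noise.
Variables (n : nat) (eps : 'I_n -> T -> R) (s2 : R).
Hypothesis meps : forall k, measurable_fun setT (eps k).
Hypothesis ieps : forall k, P.-integrable setT (EFin \o eps k).
Hypothesis ieps2 : forall k, P.-integrable setT (EFin \o (fun w => eps k w ^+ 2)).
Hypothesis Eeps : forall k, \int[P]_w eps k w = 0.
Hypothesis Eeps2 : forall k l,
  \int[P]_w (eps k w * eps l w) = if k == l then s2 else 0.
Variables (U : T -> R) (a : 'I_n -> T -> R) (C : R).
Hypotheses (mU : measurable_fun setT U) (ma : forall k, measurable_fun setT (a k)).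
Hypothesis iU2 : P.-integrable setT (EFin \o (fun w => U w ^+ 2)).
Hypothesis aC : forall k w, `|a k w| <= C.
Hypothesis indep1 : forall k, indep2 (fun w => U w * a k w) (eps k).
Hypothesis indep2' : forall k l,
  indep2 (fun w => a k w * a l w) (fun w => eps k w * eps l w).

(** Bounded weights keep every product below integrable with no more than second moments of the
    noise. *)
Let ia2 k : P.-integrable setT (EFin \o (fun w => a k w ^+ 2)).
Proof.
apply: (@integrable_le _ _ _ _ _ _ _ (cst (C ^+ 2))) => //.
- exact: measurable_funX.
- by apply: finite_measure_integrable_cst.
- move=> w _; rewrite /= normrX ler_sqr ?nnegrE //.
  exact: le_trans (normr_ge0 _) (aC k w).
Qed.

Let iUa k : P.-integrable setT (EFin \o (fun w => U w * a k w)).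
Proof. exact: integrable_sqr_mul. Qed.

Let iaa k l : P.-integrable setT (EFin \o (fun w => a k w * a l w)).
Proof. exact: integrable_sqr_mul. Qed.

Let iee k l : P.-integrable setT (EFin \o (fun w => eps k w * eps l w)).
Proof. exact: integrable_sqr_mul. Qed.

Let mUa k : measurable_fun setT (fun w => U w * a k w).
Proof. exact: measurable_funM. Qed.

Let maa k l : measurable_fun setT (fun w => a k w * a l w).
Proof. exact: measurable_funM. Qed.

Let mee k l : measurable_fun setT (fun w => eps k w * eps l w).
Proof. exact: measurable_funM. Qed.

Let sq_expand w : (U w + \sum_k a k w * eps k w) ^+ 2 =
  (U w ^+ 2 + 2 * \sum_k (U w * a k w) * eps k w) +
  \sum_k \sum_l (a k w * a l w) * (eps k w * eps l w).
Proof.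
rewrite sqrrD -mulr_natl; congr (_ + 2 * _ + _).
  by rewrite mulr_sumr; apply: eq_bigr => k _; rewrite mulrA.
rewrite expr2 mulr_suml; apply: eq_bigr => k _.
by rewrite mulr_sumr; apply: eq_bigr => l _; rewrite mulrACA.
Qed.

Let iUae k : P.-integrable setT (EFin \o (fun w => (U w * a k w) * eps k w)).
Proof. by apply: indep_integrableM => //; exact: indep1. Qed.

Let icross : P.-integrable setT
  (EFin \o (fun w => \sum_k (U w * a k w) * eps k w)).
Proof. exact: integrable_sumr. Qed.

Let iquad k l : P.-integrable setT
  (EFin \o (fun w => (a k w * a l w) * (eps k w * eps l w))).
Proof. by apply: indep_integrableM => //; exact: indep2'. Qed.

Lemma integrable_noise :
  P.-integrable setT (EFin \o (fun w => (U w + \sum_k a k w * eps k w) ^+ 2)).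
Proof.
under eq_fun do rewrite sq_expand.
apply: integrable_addr => //.
  by apply: integrable_addr => //; exact: integrable_mulr_cst.
by do 2 (apply: integrable_sumr => // ?).
Qed.

(** The cross terms vanish because each [U * a k] is independent of the centered [eps k], and the
    off-diagonal terms because the noise is uncorrelated. Being an equality, the expansion costs no
    factor on the noise. *)
Lemma Rintegral_noise :
  \int[P]_w ((U w + \sum_k a k w * eps k w) ^+ 2) =
  \int[P]_w (U w ^+ 2) + s2 * \int[P]_w (\sum_k a k w ^+ 2).
Proof.
under eq_Rintegral do rewrite sq_expand.
have i2 k : P.-integrable setT
    (EFin \o (fun w => \sum_l (a k w * a l w) * (eps k w * eps l w))).
  by apply: integrable_sumr.
rewrite RintegralD //; last by apply: integrable_sumr.
  rewrite RintegralD //; last exact: integrable_mulr_cst.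
  rewrite RintegralZl // !Rintegral_sum //.
  rewrite [X in 2 * X]big1 ?mulr0 ?addr0; last first.
    by move=> k _; rewrite indep_RintegralM // ?Eeps ?mulr0 //; exact: indep1.
  congr (_ + _); rewrite mulr_sumr; apply: eq_bigr => k _.
  rewrite Rintegral_sum // (bigD1 k) //= big1 ?addr0; last first.
    move=> l lk; rewrite indep_RintegralM //; last exact: indep2'.
    by rewrite Eeps2 eq_sym (negbTE lk) mulr0.
  rewrite indep_RintegralM //; last exact: indep2'.
  by rewrite Eeps2 eqxx mulrC.
by apply: integrable_addr => //; exact: integrable_mulr_cst.
Qed.

End noise.
End expectations.

(** * Integration by parts on an interval *)

Section integration_by_parts.
Variable R : realType.
Local Notation mu := (@lebesgue_measure R).

(** The interior of I: one-sided derivatives are ordinary derivatives there, and integrals do not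
    see the removed endpoints. *)
Definition open_itv (I : interval R) : interval R :=
  let: Interval l r := I in
  Interval (if l is BSide _ a then BRight a else l)
           (if r is BSide _ a then BLeft a else r).

Lemma open_itv_open I : open [set` open_itv I].
Proof. by case: I => l r; apply: interval_open; [case: l|case: r]. Qed.

Lemma open_itv_sub I : [set` open_itv I] `<=` [set` I].
Proof.
case: I => l r; apply: subset_itv.
- by case: l => [[] a|s] //=; rewrite bnd_simp.
- by case: r => [[] a|s] //=; rewrite bnd_simp.
Qed.

Lemma Rintegral_open_itv I (F : R -> R) : mu.-integrable [set` I] (EFin \o F) ->
  \int[mu]_(x in [set` I]) F x = \int[mu]_(x in [set` open_itv I]) F x.
Proof.
case: I => l r /= iF.
have iF' : mu.-integrable
    [set` Interval (if l is BSide _ a then BRight a else l) r] (EFin \o F).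
  apply: integrableS iF => //; apply: subset_itvr.
  by case: (l) => [[] a|s] //=; rewrite bnd_simp.
transitivity (\int[mu]_(x in
    [set` Interval (if l is BSide _ a then BRight a else l) r]) F x).
  by case: (l) iF' => [[] a|s] //= iF'; rewrite Rintegral_itv_obnd_cbnd.
case: (r) iF' => [[] a|s] //= iF'.
rewrite Rintegral_itv_bndo_bndc //.
by apply: integrableS iF' => //; apply: subset_itvl; rewrite bnd_simp.
Qed.

Lemma derivableI_cvg (I : interval R) (g : R -> R) (x : R) : x \in I -> derivableI I g ->
  g y @[y --> within [set` I] x^'] --> g x.
Proof.
move=> xI dg; have := dg x xI; rewrite /diffquotI => /cvg_ex[/= L hL].
have h2 : (g y - g x) / (y - x) * (y - x) + g x @[y --> within [set` I] x^']
    --> L * (x - x) + g x.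
  apply: cvgD; last exact: cvg_cst.
  apply: cvgM => //; apply: cvgB; last exact: cvg_cst.
  by apply: cvg_within_filter; exact: cvg_within.
rewrite subrr mulr0 add0r in h2.
apply: cvg_trans h2; apply: near_eq_cvg.
have neq : \forall y \near within [set` I] x^', y != x.
  by rewrite near_withinE; apply: filterS (nbhs_dnbhs_neq x).
by near=> y; rewrite divfK ?subrK // subr_eq0; near: y.
Unshelve. all: by end_near. Qed.

(** In Caratheodory form: the difference quotient, given its limit as value at x, is continuous at
    x. *)
Lemma derivableI_interior (I : interval R) (g : R -> R) (x : R) : x \in open_itv I -> derivableI I g ->
  is_derive x 1 g (deriveI I g x).
Proof.
move=> xI dg.
have xII : x \in I by exact: open_itv_sub.
have nI : nbhs x [set` I].
  apply: filterS (@open_itv_sub I) _.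
  by apply: open_nbhs_nbhs; split => //; exact: open_itv_open.
have wE : within [set` I] x^' = x^'.
  apply/seteqP; split => A; rewrite /within /=.
    move=> h; have nI' : x^' [set` I] by exact: nbhs_dnbhs nI.
    by apply: filterS2 h nI' => y h1 h2; exact: h1.
  by apply: filterS.
have := dg x xII; rewrite /diffquotI wE => hL.
have dE : deriveI I g x = lim ((g y - g x) / (y - x) @[y --> x^']).
  by rewrite /deriveI patchE mem_set //= /diffquotI wE.
apply/is_derive1_caratheodory.
exists (fun z => if z == x then deriveI I g x else (g z - g x) / (z - x)); split.
- move=> z; case: eqP => [->|/eqP]; first by rewrite !subrr mulr0.
  by rewrite -subr_eq0 => /divfK->.
- apply/continuous_withinNx; rewrite eqxx dE.
  apply: cvg_trans hL; apply: near_eq_cvg; near=> y.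
  by rewrite ifN //; near: y; exact: nbhs_dnbhs_neq.
- by rewrite eqxx.
Unshelve. all: by end_near. Qed.

(** One sequence treats finite, infinite, open and closed endpoints alike: whatever the meaning of
    [value_at_inf], it is the limit along interior points. *)
Lemma left_end_seq (I : interval R) (c : R) : c \in open_itv I ->
  exists s : nat -> R, [/\ forall n, s n <= c, forall n, s n \in open_itv I,
    forall x, x \in open_itv I -> \forall n \near \oo, s n <= x &
    forall (g : R -> R) v, (forall x, x \in I -> g y @[y --> within [set` I] x^'] --> g x) ->
      value_at_inf I g v -> g (s n) @[n --> \oo] --> v].
Proof.
case: I => -[b a|[]] r cI; last 2 first.
- have sc n : c - n%:R <= c by rewrite lerBlDr lerDl ler0n.
  have sy : (c - n%:R) @[n --> \oo] --> -oo.
    apply/cvgrNyPle => A; near=> n; rewrite lerBlDr -lerBlDl.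
    by near: n; exact: nbhs_infty_ger.
  exists (fun n => c - n%:R); split => //.
  + move=> n; move: cI; rewrite !itv_boundlr /= => cr; apply: le_trans cr.
    by rewrite bnd_simp.
  + by move=> x _; have /cvgrNyPle/(_ x) := sy.
  + by move=> g v _ /= gv; exact: cvg_comp sy gv.
- by move: cI; rewrite itv_boundlr.
have cI' := open_itv_sub cI.
have ac : a < c by move: cI; rewrite itv_boundlr /= bnd_simp => /andP[].
pose s n : R := a + (c - a) * n.+1%:R^-1.
have as_ n : a < s n by rewrite ltrDl mulr_gt0 ?subr_gt0 ?invr_gt0 ?ltr0n.
have sc n : s n <= c.
  rewrite -lerBrDl ler_piMr ?subr_ge0 ?(ltW ac) //.
  by rewrite invf_le1 ?ltr0n // ler1n.
have sa : s n @[n --> \oo] --> a.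
  rewrite -[X in _ --> X]addr0; apply: cvgD; first exact: cvg_cst.
  rewrite -(mulr0 (c - a)); apply: cvgM; first exact: cvg_cst.
  exact: cvg_harmonic.
have inI x : a < x -> x <= c -> x \in open_itv (Interval (BSide b a) r).
  move=> ax xc; move: cI; rewrite !itv_boundlr /= => /andP[_ cr].
  by rewrite bnd_simp ax /=; apply: le_trans cr; rewrite bnd_simp.
exists s; split => //.
- by move=> n; apply: inI.
- move=> x; rewrite itv_boundlr /= bnd_simp => /andP[ax _].
  by apply: (cvgr_le a) => //.
- move=> g v gc gv; have : g y @[y --> a^'+] --> v; last first.
    by move/cvg_at_rightP; apply; split.
  (* At an open endpoint the limit is the hypothesis itself; at a closed one it follows from
     continuity of [g] from inside I. *)
  move: gv gc; case: b {cI inI} cI' (inI) => /= cI' inI; last by [].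
  move=> <- gc; apply: cvg_trans (gc a _); last first.
    move: cI'; rewrite !itv_boundlr /= lexx => /andP[_ cr] /=.
    by apply: le_trans cr; rewrite bnd_simp ltW.
  apply: cvg_app => A; rewrite /within /= => hA.
  have hA' : nbhs a (fun y => y != a -> [set` Interval (BLeft a) r] y -> A y) by exact: hA.
  have h2 : nbhs a (fun y => y < c) by exact: lt_nbhsl.
  apply: filterS2 hA' h2 => y h yc ay; apply: h; first by rewrite gt_eqF.
  by apply: (@open_itv_sub (Interval (BLeft a) r)); apply: inI => //; exact: ltW.
Unshelve. all: by end_near. Qed.

Lemma right_end_seq (I : interval R) (c : R) : c \in open_itv I ->
  exists t : nat -> R, [/\ forall n, c <= t n, forall n, t n \in open_itv I,
    forall x, x \in open_itv I -> \forall n \near \oo, x <= t n &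
    forall (g : R -> R) v, (forall x, x \in I -> g y @[y --> within [set` I] x^'] --> g x) ->
      value_at_sup I g v -> g (t n) @[n --> \oo] --> v].
Proof.
case: I => l [b a|[]] cI; last 2 first.
- by move: cI; rewrite itv_boundlr andbF.
- have tc n : c <= c + n%:R by rewrite lerDl ler0n.
  have ty : (c + n%:R) @[n --> \oo] --> +oo.
    apply/cvgryPge => A; near=> n; rewrite -lerBlDl.
    by near: n; exact: nbhs_infty_ger.
  exists (fun n => c + n%:R); split => //.
  + move=> n; move: cI; rewrite !itv_boundlr /= !andbT => cl; apply: le_trans cl _.
    by rewrite bnd_simp.
  + by move=> x _; have /cvgryPge/(_ x) := ty.
  + by move=> g v _ /= gv; exact: cvg_comp ty gv.
have cI' := open_itv_sub cI.
have ca : c < a by move: cI; rewrite itv_boundlr /= bnd_simp => /andP[].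
pose t n : R := a - (a - c) * n.+1%:R^-1.
have ta_ n : t n < a by rewrite gtrBl mulr_gt0 ?subr_gt0 ?invr_gt0 ?ltr0n.
have tc n : c <= t n.
  rewrite lerBrDr -lerBrDl ler_piMr ?subr_ge0 ?(ltW ca) //.
  by rewrite invf_le1 ?ltr0n // ler1n.
have ta : t n @[n --> \oo] --> a.
  rewrite -[X in _ --> X]subr0; apply: cvgB; first exact: cvg_cst.
  rewrite -(mulr0 (a - c)); apply: cvgM; first exact: cvg_cst.
  exact: cvg_harmonic.
have inI x : x < a -> c <= x -> x \in open_itv (Interval l (BSide b a)).
  move=> xa cx; move: cI; rewrite !itv_boundlr /= => /andP[lc _].
  by rewrite bnd_simp xa andbT; apply: le_trans lc _; rewrite bnd_simp.
exists t; split => //.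
- by move=> n; apply: inI.
- move=> x; rewrite itv_boundlr /= bnd_simp => /andP[_ xa].
  by apply: (cvgr_ge a) => //.
- move=> g v gc gv; have : g y @[y --> a^'-] --> v; last first.
    by move/cvg_at_leftP; apply; split.
  move: gv gc; case: b {cI inI} cI' (inI) => /= cI' inI; first by [].

  move=> <- gc; apply: cvg_trans (gc a _); last first.
    move: cI'; rewrite !itv_boundlr /= lexx andbT => /andP[lc _] /=.
    by apply: le_trans lc _; rewrite bnd_simp ltW.
  apply: cvg_app => A; rewrite /within /= => hA.
  have hA' : nbhs a (fun y => y != a -> [set` Interval l (BRight a)] y -> A y) by exact: hA.
  have h2 : nbhs a (fun y => c < y) by exact: lt_nbhsr.
  apply: filterS2 hA' h2 => y h yc ay; apply: h; first by rewrite lt_eqF.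
  by apply: (@open_itv_sub (Interval l (BRight a))); apply: inI => //; exact: ltW.
Unshelve. all: by end_near. Qed.

(** The fundamental theorem is applied on compact subintervals that exhaust the interior.
    Integrability of (b g)' on I lets the integrals pass to the limit, and the boundary terms tend
    to v - v = 0. *)
Lemma integration_by_parts_itv (I : interval R) (b g : R -> R) (c v : R) :
  c \in open_itv I ->
  (forall x, derivable b x 1) -> continuous (derive1 b) ->
  derivableI I g -> {in open_itv I, continuous (deriveI I g)} ->
  mu.-integrable [set` I] (EFin \o (fun x => derive1 b x * g x)) ->
  mu.-integrable [set` I] (EFin \o (fun x => b x * deriveI I g x)) ->
  value_at_inf I (b \* g) v -> value_at_sup I (b \* g) v ->
  \int[mu]_(x in [set` I]) (derive1 b x * g x) =
  - \int[mu]_(x in [set` I]) (b x * deriveI I g x).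
Proof.
move=> cI db cb' dg cg' i1 i2 vl vr.
pose h x := derive1 b x * g x + b x * deriveI I g x.
pose k := b \* g.
have cb x : {for x, continuous b}.
  by apply/differentiable_continuous/derivable1_diffP; exact: db.
have dgi x : x \in open_itv I -> is_derive x 1 g (deriveI I g x).
  by move=> xI; exact: derivableI_interior.
have cgi x : x \in open_itv I -> {for x, continuous g}.
  move=> xI; apply/differentiable_continuous/derivable1_diffP.
  by have [] := dgi x xI.
have dk x : x \in open_itv I -> is_derive x 1 k (h x).
  move=> xI; have d1 := dgi x xI.
  have d2 : is_derive x 1 b (derive1 b x).
    by rewrite derive1E; exact: derivableP (db x).
  by apply: is_derive_eq; rewrite /h addrC mulrC.
have ih : mu.-integrable [set` I] (EFin \o h) by exact: integrable_addr.
have ch x : x \in open_itv I -> {for x, continuous h}.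
  move=> xI; apply: continuousD; apply: continuousM; [exact: cb'|exact: cgi|exact: cb|exact: cg'].
have kc x : x \in I -> k y @[y --> within [set` I] x^'] --> k x.
  move=> xI; apply: cvgM; last exact: derivableI_cvg.
  by apply: cvg_within_filter; apply: cvg_within_filter; exact: cb.
have [s [sc sI sl sv]] := left_end_seq cI.
have [t [tc tI tl tv]] := right_end_seq cI.
have sub n : `[s n, t n] `<=` [set` open_itv I].
  move=> x /=; rewrite in_itv /= => /andP[sx xt].
  have := sI n; have := tI n; case: (open_itv I) => l r.
  rewrite !itv_boundlr => /andP[_ t2] /andP[s1 _].
  apply/andP; split; first by apply: le_trans s1 _; rewrite bnd_simp.
  by apply: le_trans t2; rewrite bnd_simp.
have FTC n : (\int[mu]_(x in `[s n, t n]) (h x)%:E = (k (t n))%:E - (k (s n))%:E)%E.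
  (* The subinterval can reduce to a point, since both sequences may start at [c]. *)
  have [st|st] := eqVneq (s n) (t n).
    by rewrite st set_itv1 integral_set1 subee.
  have stn : s n < t n by rewrite lt_neqAle st (le_trans (sc n) (tc n)).
  have inn x : x \in `]s n, t n[ -> x \in open_itv I.
    by move=> xst; apply: (sub n); exact: subset_itv_oo_cc.
  apply: continuous_FTC2 => //.
  - by apply: continuous_in_subspaceT => x; rewrite inE => /sub; exact: ch.
  - split.
    + by move=> x /inn xI; have [] := dk x xI.
    + apply: cvg_at_right_filter; apply/differentiable_continuous/derivable1_diffP.
      by have [] := dk _ (sI n).
    + apply: cvg_at_left_filter; apply/differentiable_continuous/derivable1_diffP.
      by have [] := dk _ (tI n).
  - by move=> x /inn xI; rewrite derive1E; have [_ ->] := dk x xI.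
(* These truncations converge to [h] on the interior and are dominated by its absolute value. *)
pose F n := (EFin \o h) \_ `[s n, t n].
pose F0 := (EFin \o h) \_ [set` open_itv I].
have mh : measurable_fun [set` I] (EFin \o h) by exact: measurable_int ih.
have [] := @dominated_convergence _ _ _ mu [set` I] (measurable_itv I) F F0
  (abse \o (EFin \o h)).
- by move=> n; apply: (measurable_restrict (EFin \o h) _ _).1 => //; exact: measurable_funS mh.
- by apply: (measurable_restrict (EFin \o h) _ _).1 => //; exact: measurable_funS mh.
- apply: aeW => x xI; rewrite /F /F0 patchE; case: ifPn => [/set_mem xo|xo].
    apply: cvg_near_cst; near=> n; rewrite patchE mem_set //= in_itv /=.
    by apply/andP; split; near: n; [exact: sl|exact: tl].
  apply: cvg_near_cst; near=> n; rewrite patchE ifN //.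
  by apply: contraNN xo => /set_mem/sub/mem_set.
- exact: integrable_abse.
- apply: aeW => x n xI; rewrite /F patchE; case: ifP => //= _.
  by rewrite normr0 lee_fin.
move=> _ _ cvF.
have FE n : (\int[mu]_(x in [set` I]) F n x = (k (t n) - k (s n))%:E)%E.
  rewrite /F -integral_mkcondr setIidr; last first.
    by apply: subset_trans (sub n) _; exact: open_itv_sub.
  by rewrite FTC EFinB.
have F0E : (\int[mu]_(x in [set` I]) F0 x = (\int[mu]_(x in [set` I]) h x)%R%:E)%E.
  rewrite /F0 -integral_mkcondr setIidr; last exact: open_itv_sub.
  rewrite Rintegral_open_itv // EFin_Rintegral //.
  by apply: integrableS ih => //; exact: open_itv_sub.
have cv0 : (k (t n) - k (s n))%:E @[n --> \oo] --> (v - v)%:E.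
  apply: cvg_EFin; first exact: nearW.
  by apply: cvgB; [exact: tv kc vr|exact: sv kc vl].
have cv1 : (\int[mu]_(x in [set` I]) F n x)%E @[n --> \oo] --> (v - v)%:E.
  by apply: cvg_trans cv0; apply: near_eq_cvg; near=> n; rewrite FE.
have h0 : \int[mu]_(x in [set` I]) h x = 0.
  apply: EFin_inj; rewrite -F0E -(subrr v).
  by apply: (cvg_unique _ cvF).
apply/eqP; rewrite -addr_eq0; apply/eqP; rewrite -h0 /h RintegralD //.
Unshelve. all: by end_near. Qed.

End integration_by_parts.

(** * Square-integrable functions and projections *)

Section square_integrable.
Variable R : realType.
Local Notation mu := (@lebesgue_measure R).
Implicit Types g h : R -> R.

(** Square integrability over the whole line: functions on I are extended by 0, so that inner
    products need no domain. *)
Definition sqint g : Prop := measurable_fun setT g /\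
  mu.-integrable setT (EFin \o (fun x => g x ^+ 2)).

Definition dot g h : R := \int[mu]_x (g x * h x).

Lemma sqint_integrable g h : sqint g -> sqint h ->
  mu.-integrable setT (EFin \o (fun x => g x * h x)).
Proof. by move=> [mg ig] [mh ih]; exact: integrable_sqr_mul. Qed.

Lemma sqintZ a g : sqint g -> sqint (fun x => a * g x).
Proof.
move=> [mg ig]; split; first exact: measurable_funM.
by under eq_fun do rewrite exprMn; exact: integrable_mulr_cst.
Qed.

Lemma sqintD g h : sqint g -> sqint h -> sqint (fun x => g x + h x).
Proof.
move=> sg sh; have [mg ig] := sg; have [mh ih] := sh; split.
  exact: measurable_funD.
under eq_fun do rewrite sqrrD -mulr_natl.
apply: integrable_addr => //; apply: integrable_addr => //.
by apply: integrable_mulr_cst => //; exact: sqint_integrable.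
Qed.

Lemma sqintB g h : sqint g -> sqint h -> sqint (fun x => g x - h x).
Proof.
move=> sg sh; under eq_fun do rewrite -[- h _]mulN1r.
by apply: sqintD => //; exact: sqintZ.
Qed.

Lemma sqint_sum (J : Type) (s : seq J) (F : J -> R -> R) :
  (forall j, sqint (F j)) -> sqint (fun x => \sum_(j <- s) F j x).
Proof.
move=> sF; elim: s => [|j s IH].
  under eq_fun do rewrite big_nil; split => //=.
  by under eq_fun do rewrite expr0n; exact: integrable0.
by under eq_fun do rewrite big_cons; exact: sqintD.
Qed.

Lemma dotC g h : dot g h = dot h g.
Proof. by apply: eq_Rintegral => x _; rewrite mulrC. Qed.

Lemma dotDl g g' h : sqint g -> sqint g' -> sqint h ->
  dot (fun x => g x + g' x) h = dot g h + dot g' h.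
Proof.
move=> sg sg' sh; rewrite /dot -RintegralD //; try exact: sqint_integrable.
by apply: eq_Rintegral => x _; rewrite mulrDl.
Qed.

Lemma dotZl a g h : sqint g -> sqint h ->
  dot (fun x => a * g x) h = a * dot g h.
Proof.
move=> sg sh; rewrite /dot -RintegralZl //; last exact: sqint_integrable.
by apply: eq_Rintegral => x _; rewrite mulrA.
Qed.

Lemma dotBl g g' h : sqint g -> sqint g' -> sqint h ->
  dot (fun x => g x - g' x) h = dot g h - dot g' h.
Proof.
move=> sg sg' sh; rewrite /dot -RintegralB //; try exact: sqint_integrable.
by apply: eq_Rintegral => x _; rewrite mulrBl.
Qed.

Lemma dot_suml (J : Type) (s : seq J) (F : J -> R -> R) h :
  (forall j, sqint (F j)) -> sqint h ->
  dot (fun x => \sum_(j <- s) F j x) h = \sum_(j <- s) dot (F j) h.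
Proof.
move=> sF sh; rewrite /dot -Rintegral_sum //; last first.
  by move=> j; exact: sqint_integrable.
by apply: eq_Rintegral => x _; rewrite mulr_suml.
Qed.

Lemma dot_ge0 g : 0 <= dot g g.
Proof. by apply: Rintegral_ge0 => x _; rewrite -expr2 sqr_ge0. Qed.

Lemma dot_sqrD g h : sqint g -> sqint h ->
  dot (fun x => g x + h x) (fun x => g x + h x) =
  dot g g + 2 * dot g h + dot h h.
Proof.
move=> sg sh; rewrite dotDl //; last exact: sqintD.
rewrite ![dot _ (fun x => _ + _)]dotC !dotDl // (dotC h g); ring.
Qed.

Lemma dot_lincomb k (F : 'I_k -> R -> R) (c : 'rV[R]_k) h :
  (forall j, sqint (F j)) -> sqint h ->
  dot (fun x => \sum_j c 0 j * F j x) h = \sum_j c 0 j * dot (F j) h.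
Proof.
move=> sF sh; rewrite dot_suml //; last by move=> j; exact: sqintZ.
by apply: eq_bigr => j _; rewrite dotZl.
Qed.

Lemma sqint_lincomb k (F : 'I_k -> R -> R) (c : 'I_k -> R) :
  (forall j, sqint (F j)) -> sqint (fun x => \sum_j c j * F j x).
Proof. by move=> sF; apply: sqint_sum => j; exact: sqintZ. Qed.

Lemma qf_gram k (F : 'I_k -> R -> R) (c : 'rV[R]_k) :
  (forall j, sqint (F j)) ->
  qf (\matrix_(i, j) dot (F i) (F j)) c =
  dot (fun x => \sum_j c 0 j * F j x) (fun x => \sum_j c 0 j * F j x).
Proof.
move=> sF; have sl := sqint_lincomb (c 0) sF.
rewrite dot_lincomb // /qf /bilf mxE; under eq_bigr do rewrite mxE mulr_suml.
rewrite exchange_big /=; apply: eq_bigr => i _.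
rewrite dotC dot_lincomb // mulr_sumr; apply: eq_bigr => j _.
by rewrite !mxE dotC mulrAC mulrA.
Qed.

Lemma possemidef_gram_dot k (F : 'I_k -> R -> R) :
  (forall j, sqint (F j)) -> possemidef (\matrix_(i, j) dot (F i) (F j)).
Proof.
move=> sF; split=> [|c]; first by apply/matrixP => i j; rewrite !mxE dotC.
by rewrite -/(bilf _ _ _) -/(qf _ _) qf_gram // dot_ge0.
Qed.

Variable I : interval R.
Let off_I g := forall x, x \notin I -> g x = 0.

Lemma patch_off g : off_I g -> g \_ [set` I] = g.
Proof.
move=> g0; apply/funext => x; rewrite patchE; case: ifPn => // xI.
by rewrite g0 //; apply: contraNN xI => /mem_set.
Qed.

Lemma L2on_sqint g : L2on I g -> sqint (g \_ [set` I]).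
Proof.
move=> gL; split; last exact: Lfun2_integrable_sqr gL.
by move: gL; rewrite /L2on inE => /andP[/[!inE] mg _]; exact: mg.
Qed.

Lemma Rintegral_off F : (forall x, x \notin I -> F x = 0) ->
  \int[mu]_(x in [set` I]) F x = \int[mu]_x F x.
Proof. by move=> F0; rewrite Rintegral_mkcond patch_off. Qed.

Lemma dotIE g h : off_I h -> dotI I g h = dot g h.
Proof.
by move=> h0; rewrite /dotI Rintegral_off // => x xI; rewrite h0 // mulr0.
Qed.

Variable f : R -> R.
Hypotheses (mf : measurable_fun setT f) (f0 : forall x, 0 <= f x).
Hypothesis fub : has_ubound [set f x | x in [set` I]].

(** Multiplication by the square root of f turns the f-inner product into the Lebesgue one, so [Psi]
    is an ordinary Gram matrix. *)
Definition weight g : R -> R := fun x => Num.sqrt (f x) * g x.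

Lemma le_supI x : x \in I -> f x <= supI I f.
Proof. by move=> xI; apply: ub_le_sup => //; exists x. Qed.

Lemma weight_sqr_le g x : off_I g -> weight g x ^+ 2 <= supI I f * g x ^+ 2.
Proof.
move=> g0; rewrite /weight exprMn sqr_sqrtr //.
have [xI|xI] := boolP (x \in I); last by rewrite g0 // expr0n !mulr0.
by apply: ler_wpM2r; [exact: sqr_ge0|exact: le_supI].
Qed.

Lemma measurable_weight g : measurable_fun setT g -> measurable_fun setT (weight g).
Proof.
move=> mg; apply: measurable_funM => //.
by apply: measurableT_comp => //; apply: continuous_measurable_fun; exact: sqrt_continuous.
Qed.

Lemma sqint_weight g : off_I g -> sqint g -> sqint (weight g).
Proof.
move=> g0 [mg ig]; split; first exact: measurable_weight.
apply: (@integrable_le _ (measurableTypeR R) R mu setT measurableT _ (fun x => supI I f * g x ^+ 2)) => //.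
- by apply: measurable_funX; exact: measurable_weight.
- exact: integrable_mulr_cst.
- by move=> x _; rewrite ger0_norm ?sqr_ge0 // weight_sqr_le.
Qed.

Lemma dotfE g h : off_I h -> dotf I f g h = dot (weight g) (weight h).
Proof.
move=> h0; rewrite /dotf Rintegral_off => [|x xI]; last first.
  by rewrite h0 // mulr0 mul0r.
apply: eq_Rintegral => x _; rewrite /weight mulrACA -expr2 sqr_sqrtr //; ring.
Qed.

Lemma sqnormf_le g : off_I g -> sqint g ->
  sqnormf I f g <= supI I f * sqnormI I g.
Proof.
move=> g0 sg; rewrite /sqnormf /sqnormI dotfE // dotIE // /dot -RintegralZl //; last first.
  exact: sqint_integrable.
apply: le_Rintegral => //; last by move=> x _; rewrite -!expr2 weight_sqr_le.
  by apply: sqint_integrable; exact: sqint_weight.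
by apply: integrable_mulr_cst => //; exact: sqint_integrable.
Qed.

Lemma expectation_sqr d (T : measurableType d) (P : probability T R)
    (X : {RV P >-> R}) g :
  (forall A : set R, measurable A ->
    distribution P X A = (\int[mu]_(x in A) (f x)%:E)%E) ->
  off_I g -> sqint g ->
  P.-integrable setT (EFin \o (fun w => g (X w) ^+ 2)) /\
  \int[P]_w (g (X w) ^+ 2) = sqnormf I f g.
Proof.
move=> law g0 sg; have [mg ig] := sg.
have [mw iw] := sqint_weight g0 sg.
have E : (\int[P]_w (g (X w) ^+ 2)%:E = \int[mu]_x (weight g x ^+ 2)%:E)%E.
  rewrite (integral_density (h := fun x => (g x ^+ 2)%:E) mf f0 law).
  - by apply: eq_integral => x _; rewrite -EFinM /weight exprMn sqr_sqrtr // mulrC.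
  - by apply/measurable_EFinP; exact: measurable_funX.
  - by move=> x; rewrite lee_fin sqr_ge0.
split.
  apply: ge0_integrable => //; last by rewrite E; exact: integrable_lty.
    apply: measurable_funX; exact: measurableT_comp.
  by move=> w _; exact: sqr_ge0.
rewrite /sqnormf dotfE // /Rintegral E /dot /Rintegral.
by under [in RHS]eq_integral do rewrite -expr2.
Qed.

End square_integrable.

(** * Empirical and theoretical Gram matrices *)

Section sample.
Variables (R : realType) (I : interval R) (phi : nat -> R -> R).

Definition lincomb k (c : 'rV[R]_k) : R -> R := fun x => \sum_j c 0 j * phi j x.

Lemma linspan_lincomb k (c : 'rV[R]_k) : linspan phi k (lincomb c).
Proof. by exists (c 0). Qed.

Lemma linspanP k t : linspan phi k t -> exists c : 'rV[R]_k, t = lincomb c.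
Proof.
move=> [c tE]; exists (\row_j c j); apply/funext => x; rewrite tE.
by apply: eq_bigr => j _; rewrite mxE.
Qed.

(** Padding with zeros embeds S_m in S_{m+p}, so a comparison of norms at the larger level descends
    to the smaller one. *)
Lemma lincomb_pad m p (c : 'rV[R]_m) :
  lincomb (row_mx c (0 : 'rV[R]_p)) = lincomb c.
Proof.
apply/funext => x; rewrite /lincomb big_split_ord /= [X in _ + X]big1 ?addr0.
  by apply: eq_bigr => j _; rewrite row_mxEl.
by move=> j _; rewrite row_mxEr mxE mul0r.
Qed.

Lemma mulmx_hatPhi n k (x : 'I_n -> R) (c : 'rV[R]_k) i :
  (c *m (hatPhi phi k x)^T) 0 i = lincomb c (x i).
Proof. by rewrite mxE; apply: eq_bigr => j _; rewrite !mxE. Qed.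

Lemma sqnormn_lincomb n k (x : 'I_n -> R) (c : 'rV[R]_k) :
  sqnormn x (lincomb c) = qf (hatPsi phi k x) c.
Proof.
rewrite /hatPsi gram_qf sqnE; congr (_ * _); apply: eq_bigr => i _.
by rewrite mulmx_hatPhi.
Qed.

(** Stability means that |v| <= (B / L) |v H| for all v. This covers invertibility too: a kernel
    vector would have norm 0, while a singular H makes the extended-real product infinite. *)
Lemma stability_psd k (H : 'M[R]_k) (L B : R) : frakL I phi k = L%:E -> 0 < L ->
  stability I phi H B <->
  L <= B /\ forall v, 0 <= qf ((B / L) ^+ 2 *: (H *m H^T) - 1%:M) v.
Proof.
move=> LE L0; rewrite /stability LE /opnorm_inv.
have qE v : qf ((B / L) ^+ 2 *: (H *m H^T) - 1%:M) v =
    (B / L) ^+ 2 * sqn (v *m H) - sqn v.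
  rewrite qfB -sqn_qf1 sqn_mulmx; congr (_ - _).
  by rewrite /qf /bilf -scalemxAr -scalemxAl mxE.
split=> [|[LB psd]].
  case: ifPn => Hu; last first.
    by rewrite maxye mulry gtr0_sg // mul1e leye_eq.
  rewrite -EFin_max -EFinM lee_fin => h; split.
    apply: le_trans h; rewrite ler_pMr //.
    by rewrite le_max lexx orbT.
  move=> v; rewrite qE subr_ge0.
  have op : opnorm (invmx H) <= B / L.
    rewrite ler_pdivlMr // mulrC; apply: le_trans h; rewrite ler_pM2l //.
    by rewrite le_max lexx.
  have := sqn_le_opnorm (invmx H) (v *m H); rewrite mulmxK // => h1.
  apply: le_trans h1 _; apply: ler_wpM2r; first exact: sqn_ge0.
  by rewrite ler_sqr ?nnegrE ?opnorm_ge0 // (le_trans (opnorm_ge0 _) op).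
have BL : 0 <= B / L by rewrite divr_ge0 ?(ltW L0) // (le_trans (ltW L0) LB).
have h v : sqn v <= (B / L) ^+ 2 * sqn (v *m H).
  by have := psd v; rewrite qE subr_ge0.
have Hu : H \in unitmx.
  rewrite -row_free_unit -kermx_eq0; apply/eqP/row_matrixP => i; rewrite row0.
  apply: sqn_eq0; apply/eqP; rewrite eq_le sqn_ge0 andbT.
  apply: le_trans (h _) _; rewrite -row_mul mulmx_ker row0.
  by rewrite /sqn mul0mx mxE mulr0.
rewrite Hu -EFin_max -EFinM lee_fin mulrC -ler_pdivlMr // ge_max.
apply/andP; split; last by rewrite ler_pdivlMr // mul1r.
apply: opnorm_le => // v.
by have := h (v *m invmx H); rewrite mulmxKV.
Qed.

Lemma stability_unitmx k (H : 'M[R]_k) (L B : R) : frakL I phi k = L%:E ->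
  0 < L -> stability I phi H B -> H \in unitmx.
Proof.
move=> LE L0; rewrite /stability /opnorm_inv LE; case: ifP => // _.
by rewrite maxye mulry gtr0_sg // mul1e leye_eq.
Qed.

Variable f : R -> R.
Hypotheses (mf : measurable_fun setT f) (f0 : forall x, 0 <= f x).
Hypothesis fub : has_ubound [set f x | x in [set` I]].
Hypothesis phi_sq : forall j, sqint (phi j).
Hypothesis phi_off : forall j x, x \notin I -> phi j x = 0.

Lemma lincomb_off k (c : 'rV[R]_k) x : x \notin I -> lincomb c x = 0.
Proof. by move=> xI; apply: big1 => j _; rewrite phi_off // mulr0. Qed.

Lemma sqint_lincombphi k (c : 'rV[R]_k) : sqint (lincomb c).
Proof. by apply: (sqint_lincomb (F := fun j : 'I_k => phi j)). Qed.

Lemma PsiE k : Psi I phi f k =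
  \matrix_(i, j) dot (weight f (phi i)) (weight f (phi j)).
Proof. by apply/matrixP => i j; rewrite !mxE (@dotfE _ I f) //; exact: phi_off. Qed.

Lemma weight_sq j : sqint (weight f (phi j)).
Proof. by apply: (@sqint_weight _ I) => //; exact: phi_off. Qed.

Lemma possemidef_Psi k : possemidef (Psi I phi f k).
Proof.
rewrite PsiE; apply: (possemidef_gram_dot (F := fun j : 'I_k => weight f (phi j))) => j.
exact: weight_sq.
Qed.

Lemma sqnormf_lincomb k (c : 'rV[R]_k) :
  sqnormf I f (lincomb c) = qf (Psi I phi f k) c.
Proof.
rewrite PsiE (qf_gram (F := fun j : 'I_k => weight f (phi j))); last first.
  by move=> j; exact: weight_sq.
rewrite /sqnormf (@dotfE _ I f) //; last exact: lincomb_off.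
congr dot; apply/funext => x; rewrite /weight /lincomb mulr_sumr;
  by apply: eq_bigr => j _; rewrite mulrCA.
Qed.

Definition Omega_at n k (x : 'I_n -> R) := forall t, linspan phi k t ->
  sqnormf I f t != 0 -> `|sqnormn x t / sqnormf I f t - 1| <= 2^-1.

(** As [Psi] is invertible, only v = 0 has zero f-norm, so the functions excluded from the ratio
    satisfy both inequalities trivially. *)
Lemma OmegaP n k (x : 'I_n -> R) : Psi I phi f k \in unitmx ->
  Omega_at k x <->
  (forall v, 0 <= qf (hatPsi phi k x - 2^-1 *: Psi I phi f k) v) /\
  (forall v, 0 <= qf ((3 / 2) *: Psi I phi f k - hatPsi phi k x) v).
Proof.
move=> Pu; set S := Psi I phi f k; set H := hatPsi phi k x.
have pS : possemidef S := possemidef_Psi k.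
have qZ a v : qf (a *: S) v = a * qf S v.
  by rewrite /qf /bilf -scalemxAr -scalemxAl mxE.
have key v : qf S v != 0 ->
    (`|qf H v / qf S v - 1| <= 2^-1) =
    ((0 <= qf (H - 2^-1 *: S) v) && (0 <= qf ((3 / 2) *: S - H) v)).
  move=> Sv; have Sp : 0 < qf S v by rewrite lt_def Sv; exact: pS.2.
  rewrite ler_norml !qfB !qZ !subr_ge0 lerBrDr lerBlDr.
  rewrite ler_pdivlMr // ler_pdivrMr //.
  have -> : - 2^-1 + 1 = 2^-1 :> R by field.
  by have -> : 2^-1 + 1 = 3 / 2 :> R by field.
split=> [Om|[h1 h2] t /linspanP[v ->]].
  suff h v : 0 <= qf (H - 2^-1 *: S) v /\ 0 <= qf ((3 / 2) *: S - H) v.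
    by split=> v; case: (h v).
  have [S0|Sn] := eqVneq (qf S v) 0.
    have v0 : v = 0.
      by rewrite -[v](mulmxK Pu) -/S (psd_qf0 pS S0) mul0mx.
    by rewrite v0 /qf /bilf !mul0mx !mxE.
  by apply/andP; rewrite -key // -sqnormn_lincomb -sqnormf_lincomb; apply: Om;
    [exact: linspan_lincomb|rewrite sqnormf_lincomb].
by rewrite sqnormf_lincomb sqnormn_lincomb => Sn; rewrite key // h1 h2.
Qed.

Lemma Omega_hatPsi_le n m p (x : 'I_n -> R) :
  Psi I phi f (m + p) \in unitmx -> Omega_at (m + p) x ->
  forall v, qf (hatPsi phi m x) v <= 3 / 2 * qf (Psi I phi f m) v.
Proof.
move=> Pu /(OmegaP _ Pu)[_ h] v; have := h (row_mx v 0).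
rewrite qfB subr_ge0.
have -> : qf ((3 / 2) *: Psi I phi f (m + p)) (row_mx v 0) =
    3 / 2 * qf (Psi I phi f (m + p)) (row_mx v 0).
  by rewrite /qf /bilf -scalemxAr -scalemxAl mxE.
by rewrite -!sqnormn_lincomb -!sqnormf_lincomb lincomb_pad.
Qed.

Lemma Omega_Psi_le n k (x : 'I_n -> R) :
  Psi I phi f k \in unitmx -> Omega_at k x ->
  forall v, qf (Psi I phi f k) v <= 2 * qf (hatPsi phi k x) v.
Proof.
move=> Pu /(OmegaP _ Pu)[h _] v; have := h v.
rewrite qfB.
have -> : qf (2^-1 *: Psi I phi f k) v = 2^-1 * qf (Psi I phi f k) v.
  by rewrite /qf /bilf -scalemxAr -scalemxAl mxE.
lra.
Qed.

(** Cauchy-Schwarz at each sample point; points outside I contribute nothing, and the sum of squares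
    over m functions is at most that over m + p. *)
Lemma hatPsi_le_frakL n m p (x : 'I_n -> R) (L : R) : (0 < n)%N ->
  frakL I phi (m + p) = L%:E -> 0 <= L ->
  forall v, qf (hatPsi phi m x) v <= L * sqn v.
Proof.
move=> n0 LE L0 v; rewrite -sqnormn_lincomb /sqnormn ler_pdivrMl ?ltr0n //.
have -> : n%:R * (L * sqn v) = \sum_(i < n) L * sqn v.
  by rewrite sumr_const card_ord mulr_natl.
apply: ler_sum => i _.
have xL : \sum_(j < m) phi j (x i) ^+ 2 <= L.
  have [xI|xI] := boolP (x i \in I); last first.
    by rewrite big1 // => j _; rewrite phi_off // expr0n.
  rewrite -lee_fin -LE; apply: (@le_trans _ _ (\sum_(j < m + p) phi j (x i) ^+ 2)%:E).
    by rewrite lee_fin big_split_ord /= lerDl sumr_ge0 // => j _; exact: sqr_ge0.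
  by apply: ereal_sup_ubound; exists (x i).
pose u : 'rV[R]_m := \row_j phi j (x i).
have -> : lincomb v (x i) = (v *m u^T) 0 0.
  by rewrite mxE; apply: eq_bigr => j _; rewrite !mxE.
apply: le_trans (cauchy_schwarz_sqn v u) _; rewrite mulrC.
apply: ler_wpM2r; first exact: sqn_ge0.
by apply: le_trans xL; rewrite sqnE; apply: ler_sum => j _; rewrite mxE.
Qed.

End sample.

(** * Statistics of the sample *)

Section statistics.
Variable R : realType.

(* A Borel function of the sample, phrased so that it can be instantiated both
   with the ambient sigma-algebra and with the one generated by the sample. *)
Definition borel_stat n (g : ('I_n -> R) -> R) : Prop :=
  forall d (T : measurableType d) (x : 'I_n -> T -> R),
    (forall i, measurable_fun setT (x i)) ->
    measurable_fun setT (fun w => g (x^~ w)).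

Definition borel_event n (E : set ('I_n -> R)) : Prop :=
  forall d (T : measurableType d) (x : 'I_n -> T -> R),
    (forall i, measurable_fun setT (x i)) -> measurable [set w | E (x^~ w)].

Lemma borel_stat_indic n (E : set ('I_n -> R)) :
  borel_event E -> borel_stat (\1_E : ('I_n -> R) -> R).
Proof.
move=> bE d T x mx.
have -> : (fun w => \1_E (x^~ w)) = \1_[set w | E (x^~ w)] :> (T -> R).
  by apply/funext => w; rewrite !indicE.
by apply: measurable_indic; exact: bE.
Qed.

(** Instantiating [borel_stat] with the sigma-algebra generated by the sample places preimages in
    [sigma_of], where independence of the families is stated. *)
Lemma sigma_of_stat d (T : measurableType d) n (X : 'I_n -> T -> R)
    (g : ('I_n -> R) -> R) : borel_stat g -> forall A, measurable A ->
  sigma_of X ((fun w => g (X^~ w)) @^-1` A).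
Proof.
move=> bg A mA.
pose G := \bigcup_(i in [set: 'I_n]) preimage_set_system setT (X i) measurable.
have mX i : measurable_fun setT (X i : g_sigma_algebraType G -> R).
  move=> _ B mB; apply: sub_sigma_algebra; exists i => //.
  by exists B.
have := bg _ (g_sigma_algebraType G) X mX measurableT A mA.
by rewrite setTI.
Qed.

Variables (I : interval R) (phi : nat -> R -> R) (f : R -> R) (n m p : nat).
Variables (Delta : 'M[R]_(m, m + p)) (L B : R).
Hypothesis n_gt0 : (0 < n)%N.
Hypotheses (mf : measurable_fun setT f) (f0 : forall x, 0 <= f x).
Hypothesis fub : has_ubound [set f x | x in [set` I]].
Hypothesis phi_sq : forall j, sqint (phi j).
Hypothesis phi_off : forall j x, x \notin I -> phi j x = 0.
Hypotheses (LE : frakL I phi (m + p) = L%:E) (L_gt0 : 0 < L).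
Hypothesis Psi_unit : Psi I phi f (m + p) \in unitmx.

Local Notation Psi_N := (Psi I phi f (m + p)).
Local Notation Psi_m := (Psi I phi f m).
Local Notation D := (Deltaf2 I phi f Delta).
Local Notation C := (B * opnorm Delta ^+ 2).

Definition Lambda_at (x : 'I_n -> R) : Prop :=
  stability I phi (hatPsi phi (m + p) x) B.

Definition Good : set ('I_n -> R) :=
  [set x | Lambda_at x /\ Omega_at I phi f (m + p) x].

(* The row vector [y *m smoother x] lists the values at the sample points of
   minus the estimator computed from the responses [y]. *)
Definition smoother (x : 'I_n -> R) : 'M[R]_n :=
  let F := hatPhi phi (m + p) x in
  n%:R^-1 *: (F *m invmx (n%:R^-1 *: (F^T *m F)) *m Delta^T *m (hatPhi phi m x)^T).

Lemma smootherE x (y : 'rV[R]_n) :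
  y *m smoother x = lsq (hatPhi phi (m + p) x) y *m Delta^T *m (hatPhi phi m x)^T.
Proof. by rewrite /smoother /lsq -scalemxAr -!scalemxAl !mulmxA. Qed.

Lemma hatb_smoother x (y : 'cV[R]_n) i :
  hatb phi Delta x y (x i) = - (y^T *m smoother x) 0 i.
Proof.
rewrite smootherE /hatb.
transitivity (((hattheta phi Delta x y)^T *m (hatPhi phi m x)^T) 0 i).
  by rewrite mxE; apply: eq_bigr => j _; rewrite !mxE.
have thetaE : (hattheta phi Delta x y)^T =
    - (lsq (hatPhi phi (m + p) x) y^T *m Delta^T); last first.
  by rewrite thetaE mulNmx mxE.
rewrite /hattheta /lsq linearN /= linearZ /= !trmx_mul trmxK trmx_inv.
rewrite -/(hatPsi phi (m + p) x).
have -> : (hatPsi phi (m + p) x)^T = hatPsi phi (m + p) x.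
  by case: (possemidef_scaled_gram (hatPhi phi (m + p) x)).
by rewrite -!scalemxAl !mulmxA.
Qed.

Lemma Lambda_unitmx x : Lambda_at x -> hatPsi phi (m + p) x \in unitmx.
Proof. exact: (stability_unitmx LE L_gt0). Qed.

Lemma Lambda_opnorm x : Lambda_at x ->
  L * opnorm (invmx (hatPsi phi (m + p) x)) <= B.
Proof.
move=> Lx; have Hu := Lambda_unitmx Lx.
move: Lx; rewrite /Lambda_at /stability /opnorm_inv LE Hu -EFin_max -EFinM lee_fin.
by apply: le_trans; rewrite ler_pM2l // le_max lexx.
Qed.

Lemma smoother_le x (y : 'rV[R]_n) : Lambda_at x ->
  sqn (y *m smoother x) <= C * sqn y.
Proof.
move=> Lx; have Hu := Lambda_unitmx Lx; rewrite smootherE.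
have := lsq_estimate_le Delta n_gt0 Hu y (ltW L_gt0)
  (hatPsi_le_frakL phi_off x n_gt0 LE (ltW L_gt0)).
rewrite mulrCA ler_pM2l ?invr_gt0 ?ltr0n // => /le_trans; apply.
by rewrite !ler_wpM2r ?sqn_ge0 ?sqr_ge0 // Lambda_opnorm.
Qed.

Lemma smoother_entry_le x i k : Lambda_at x -> `|smoother x k i| <= Num.sqrt C.
Proof.
move=> Lx; have := smoother_le (delta_mx 0 k) Lx.
have -> : sqn (delta_mx 0 k : 'rV[R]_n) = 1.
  rewrite sqnE (bigD1 k) //= big1 => [|j /negbTE jk].
    by rewrite mxE !eqxx addr0 expr1n.
  by rewrite mxE jk andbF expr0n.
rewrite mulr1 -rowE sqnE => h; rewrite -sqrtr_sqr ler_wsqrtr //.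
apply: le_trans h; rewrite (bigD1 i) //= [row k _ 0 i]mxE lerDl.
by apply: sumr_ge0 => j _; exact: sqr_ge0.
Qed.

Lemma smoother_residual_le x (y : 'rV[R]_n) : Good x ->
  sqn (y *m smoother x) <= 3 * opnorm D ^+ 2 * sqn y.
Proof.
move=> [Lx Ox]; have Hu := Lambda_unitmx Lx; rewrite smootherE.
have pN := possemidef_Psi mf f0 fub phi_sq phi_off (m + p).
have pm := possemidef_Psi mf f0 fub phi_sq phi_off m.
have := lsq_residual_le (G := hatPhi phi m x) Delta n_gt0 Hu Psi_unit pN pm
  (Omega_Psi_le mf f0 fub phi_sq phi_off Psi_unit Ox) y
  (Omega_hatPsi_le mf f0 fub phi_sq phi_off Psi_unit Ox).
by rewrite mulrCA ler_pM2l ?invr_gt0 ?ltr0n.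
Qed.

(* Elements of S_m whose squared f-norms add up to [sqfrobenius D]. *)
Definition noise_dir l : R -> R :=
  lincomb phi (row l (Delta *m invmx (sqrtmx Psi_N))^T).

Lemma smoother_noise_le x : Good x ->
  \sum_i \sum_k smoother x k i ^+ 2 <=
  2 / n%:R * \sum_l \sum_i noise_dir l (x i) ^+ 2.
Proof.
move=> [Lx Ox]; have Hu := Lambda_unitmx Lx.
have pN := possemidef_Psi mf f0 fub phi_sq phi_off (m + p).
rewrite [X in _ * X]exchange_big mulr_sumr; apply: ler_sum => i _.
have := lsq_noise_le (hatPhi phi m x) Delta n_gt0 Hu Psi_unit pN
  (Omega_Psi_le mf f0 fub phi_sq phi_off Psi_unit Ox) i.
rewrite !sqnE => h.
have -> : \sum_k smoother x k i ^+ 2 = \sum_j row i (smoother x)^T 0 j ^+ 2.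
  by apply: eq_bigr => k _; rewrite [row i _ 0 k]mxE [(smoother x)^T i k]mxE.
apply: le_trans h _; rewrite le_eqVlt; apply/orP; left; apply/eqP.
congr (_ * _); apply: eq_bigr => l _; congr (_ ^+ 2).
rewrite /noise_dir -mulmx_hatPhi -row_mul.
by rewrite -trmx_mul !mxE.
Qed.

(** Sample points outside I have a zero row in [hatPhi], so their responses are ignored. *)
Lemma smoother_off x (y : 'rV[R]_n) : (forall i, x i \in I -> y 0 i = 0) ->
  y *m smoother x = 0.
Proof.
move=> y0; rewrite /smoother -scalemxAr !mulmxA.
suff -> : y *m hatPhi phi (m + p) x = 0 by rewrite !mul0mx scaler0.
apply/rowP => j; rewrite !mxE big1 // => i _; rewrite mxE.
have [xI|xI] := boolP (x i \in I); first by rewrite y0 // mul0r.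
by rewrite phi_off // mulr0.
Qed.

Lemma hatb_decomp x (b : R -> R) (e : 'I_n -> R) (theta : 'rV[R]_(m + p)) i :
  Lambda_at x ->
  hatb phi Delta x (\col_k (b (x k) + e k)) (x i) =
  lincomb phi (- (theta *m Delta^T)) (x i)
  - ((\row_k ((b \_ [set` I]) (x k) - lincomb phi theta (x k))) *m smoother x) 0 i
  - \sum_k e k * smoother x k i.
Proof.
move=> Lx; have Hu := Lambda_unitmx Lx; rewrite hatb_smoother.
set y := (\col__ _)^T; set rr := \row__ (_ - _).
(* The part of b outside I; the responses split into an element of S_{m+p}, which is reproduced, the
   residual, the noise and this part. *)
pose out : 'rV[R]_n := \row_k (b (x k) - (b \_ [set` I]) (x k)).
have yE : y = theta *m (hatPhi phi (m + p) x)^T + rr + (\row_k e k) + out.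
  apply/rowP => k; rewrite 3![in RHS]mxE mulmx_hatPhi !mxE; ring.
have out0 : out *m smoother x = 0.
  by apply: smoother_off => k xI; rewrite mxE patchE mem_set // subrr.
rewrite yE !mulmxDl out0 addr0 [X in X + _ + _]smootherE lsq_fit //.
rewrite [X in - X = _]mxE [X in - (X + _) = _]mxE mulmx_hatPhi !opprD.
congr (_ + _ + - _).
  by rewrite /lincomb -sumrN; apply: eq_bigr => j _; rewrite [in RHS]mxE mulNr.
by rewrite mxE; apply: eq_bigr => k _; rewrite mxE.
Qed.

Lemma measurable_hatPhi k d (T : measurableType d) (x : 'I_n -> T -> R) :
  (forall i, measurable_fun setT (x i)) ->
  measurable_mx (fun w => hatPhi phi k (x^~ w)).
Proof.
move=> mx i j; under eq_fun do rewrite mxE.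
by apply: measurableT_comp => //; case: (phi_sq j).
Qed.

Lemma measurable_hatPsi k d (T : measurableType d) (x : 'I_n -> T -> R) :
  (forall i, measurable_fun setT (x i)) ->
  measurable_mx (fun w => hatPsi phi k (x^~ w)).
Proof.
move=> mx; apply: measurable_scalemx; apply: measurable_mulmx.
  by apply: measurable_trmx; exact: measurable_hatPhi.
exact: measurable_hatPhi.
Qed.

Lemma borel_smoother i j : borel_stat (fun x => smoother x i j).
Proof.
move=> d T x mx; apply: (measurable_scalemx n%:R^-1).
apply: measurable_mulmx; last by apply: measurable_trmx; exact: measurable_hatPhi.
apply: measurable_mulmx; last exact: measurable_cst_mx.
apply: measurable_mulmx; first exact: measurable_hatPhi.
by apply: measurable_invmx; exact: measurable_hatPsi.
Qed.

Lemma borel_Lambda : borel_event Lambda_at.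
Proof.
move=> d T x mx; rewrite /Lambda_at.
have -> : [set w | stability I phi (hatPsi phi (m + p) (x^~ w)) B] =
    [set _ | L <= B] `&` [set w | forall v, 0 <= qf ((B / L) ^+ 2 *:
      (hatPsi phi (m + p) (x^~ w) *m (hatPsi phi (m + p) (x^~ w))^T) - 1%:M) v].
  by apply/seteqP; split => w /= /(stability_psd _ _ LE L_gt0).
apply: measurableI; first by case: (L <= B); rewrite ?set_true ?set_false.
apply: measurable_psd; apply: measurable_addmx; last exact: measurable_cst_mx.
apply: measurable_scalemx; apply: measurable_mulmx; first exact: measurable_hatPsi.
by apply: measurable_trmx; exact: measurable_hatPsi.
Qed.

Lemma borel_Omega : borel_event (Omega_at I phi f (m + p) : set ('I_n -> R)).
Proof.
move=> d T x mx.
have -> : [set w | Omega_at I phi f (m + p) (x^~ w)] =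
    [set w | forall v, 0 <= qf (hatPsi phi (m + p) (x^~ w) - 2^-1 *: Psi_N) v] `&`
    [set w | forall v, 0 <= qf ((3 / 2) *: Psi_N - hatPsi phi (m + p) (x^~ w)) v].
  by apply/seteqP; split => w /= /(OmegaP mf f0 fub phi_sq phi_off _ Psi_unit).
have mH : measurable_mx (fun w => hatPsi phi (m + p) (x^~ w)).
  exact: measurable_hatPsi.
apply: measurableI; apply: measurable_psd; apply: measurable_addmx => //.
by move=> i j; under eq_fun do rewrite mxE; apply: measurable_funN; exact: mH.
Qed.

Lemma borel_Good : borel_event Good.
Proof.
by move=> d T x mx; apply: measurableI; [exact: borel_Lambda|exact: borel_Omega].
Qed.

Variables (q r : R -> R).
Hypotheses (mq : measurable_fun setT q) (mr : measurable_fun setT r).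

(* On [Good], the error of the estimator at [x i] is
   [signal_stat i x + \sum_k noise_stat i k x * eps k]. *)
Definition signal_stat i (x : 'I_n -> R) : R :=
  \1_Good x * (q (x i) - ((\row_k r (x k)) *m smoother x) 0 i).

Definition noise_stat i k (x : 'I_n -> R) : R := \1_Good x * - smoother x k i.

Lemma borel_noise_stat i k : borel_stat (noise_stat i k).
Proof.
move=> d T x mx; apply: measurable_funM.
  by apply: (borel_stat_indic borel_Good).
by apply: measurable_funN; exact: borel_smoother.
Qed.

Lemma borel_signal_stat i : borel_stat (signal_stat i).
Proof.
move=> d T x mx; apply: measurable_funM.
  by apply: (borel_stat_indic borel_Good).
apply: measurable_funB; first exact: measurableT_comp.
apply: measurable_mulmx => [a k|a b]; last exact: borel_smoother.
by under eq_fun do rewrite mxE; exact: measurableT_comp.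
Qed.

Lemma noise_stat_le i k x : `|noise_stat i k x| <= Num.sqrt C.
Proof.
rewrite /noise_stat indicE; have [/set_mem[Lx _]|_] := boolP (x \in Good).
  by rewrite mul1r normrN smoother_entry_le.
by rewrite mul0r normr0 sqrtr_ge0.
Qed.

(** The factor 6 is 2 * 3, from the square of a difference and [smoother_residual_le]. *)
Lemma sum_signal_stat_le x : \sum_i signal_stat i x ^+ 2 <=
  2 * \sum_i q (x i) ^+ 2 + 6 * opnorm D ^+ 2 * \sum_i r (x i) ^+ 2.
Proof.
have s0 (g : R -> R) : 0 <= \sum_i g (x i) ^+ 2.
  by apply: sumr_ge0 => i _; exact: sqr_ge0.
have [Gx|Gx] := boolP (x \in Good); last first.
  rewrite big1 => [|i _]; last by rewrite /signal_stat indicE (negbTE Gx) mul0r expr0n.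
  apply: addr_ge0; first by apply: mulr_ge0 => //; exact: s0.
  by apply: mulr_ge0; [rewrite mulr_ge0 ?sqr_ge0|exact: s0].
have := smoother_residual_le (\row_k r (x k)) (set_mem Gx).
rewrite !sqnE; set S1 := \sum_j _; set S2 := \sum_j _ => h.
have -> : \sum_i r (x i) ^+ 2 = S2 by apply: eq_bigr => i _; rewrite mxE.
apply: (@le_trans _ _ (2 * \sum_i q (x i) ^+ 2 + 2 * S1)); last first.
  by rewrite lerD2l; have := h; lra.
rewrite !mulr_sumr -big_split /=; apply: ler_sum => i _.
rewrite /signal_stat indicE Gx mul1r.
set a := q _; set b := (_ *m _) 0 i.
have := sqr_ge0 (a + b); nra.
Qed.

Lemma sum_noise_stat_le x : \sum_i \sum_k noise_stat i k x ^+ 2 <=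
  2 / n%:R * \sum_l \sum_i noise_dir l (x i) ^+ 2.
Proof.
have [Gx|Gx] := boolP (x \in Good); last first.
  rewrite big1 => [|i _].
    rewrite mulr_ge0 ?divr_ge0 //; apply: sumr_ge0 => l _.
    by apply: sumr_ge0 => i _; exact: sqr_ge0.
  by apply: big1 => k _; rewrite /noise_stat indicE (negbTE Gx) mul0r expr0n.
apply: le_trans (smoother_noise_le (set_mem Gx)).
apply: ler_sum => i _; apply: ler_sum => k _.
by rewrite /noise_stat indicE Gx mul1r sqrrN.
Qed.

End statistics.

(** * Projections on the basis and coefficients of the derivative *)

Section projections.
Variables (R : realType) (I : interval R) (phi : nat -> R -> R).
Local Notation mu := (@lebesgue_measure R).
Hypothesis basis : hilbert_basis I phi.
Hypothesis phi_off : forall j x, x \notin I -> phi j x = 0.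

Lemma basis_sqint j : sqint (phi j).
Proof.
have [phiL _ _] := basis.
by rewrite -(patch_off (phi_off j)); apply: L2on_sqint.
Qed.

Lemma basis_dot j k : dot (phi j) (phi k) = (j == k)%:R.
Proof.
have [_ ortho _] := basis.
by rewrite -ortho; apply/esym/dotIE; exact: phi_off.
Qed.

(** With an empty interior, the first basis function would have norm 0 instead of 1. *)
Lemma basis_open_itv : exists c, c \in open_itv I.
Proof.
have [E0|/set0P[c cI]] := eqVneq [set` open_itv I] set0; last by exists c.
have [_ ortho _] := basis.
have := ortho 0%N 0%N; rewrite /dotI Rintegral_open_itv.
  by rewrite E0 Rintegral_set0 => /esym/eqP; rewrite oner_eq0.
apply: integrableS (sqint_integrable (basis_sqint 0) (basis_sqint 0)) => //.
Qed.

(** A supremum at most 0 would force the first basis function to vanish identically, against its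
    unit norm. *)
Lemma frakL_pos k : (0 < k)%N -> (frakL I phi k < +oo)%E ->
  exists2 L, frakL I phi k = L%:E & 0 < L.
Proof.
move=> k0 Loo; have [c /open_itv_sub cI] := basis_open_itv.
have le x : x \in I -> ((\sum_(j < k) phi j x ^+ 2)%:E <= frakL I phi k)%E.
  by move=> xI; apply: ereal_sup_ubound; exists x.
have s0 x : 0 <= \sum_(j < k) phi j x ^+ 2.
  by apply: sumr_ge0 => j _; exact: sqr_ge0.
have Lfin : frakL I phi k \is a fin_num.
  rewrite fin_numE -ltey Loo andbT gt_eqF // (lt_le_trans _ (le _ cI)) //.
  exact: ltNye.
exists (fine (frakL I phi k)); first by rewrite fineK.
rewrite ltNge; apply/negP => L0.
have phi0 x : phi 0%N x = 0.
  have [xI|] := boolP (x \in I); last exact: phi_off.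
  have := le x xI; rewrite -(fineK Lfin) lee_fin => /le_trans/(_ L0) h.
  have /eqP := le_anti (introT andP (conj h (s0 x))).
  rewrite psumr_eq0; last by move=> j _; exact: sqr_ge0.
  by move=> /allP/(_ (Ordinal k0) (mem_index_enum _)); rewrite sqrf_eq0 => /eqP.
have := basis_dot 0%N 0%N; rewrite eqxx /dot.
under eq_Rintegral do rewrite phi0 mulr0.
by rewrite /Rintegral integral0 /= => /esym/eqP; rewrite oner_eq0.
Qed.

Lemma dot_lincomb_basis k (c : 'rV[R]_k) (j : 'I_k) :
  dot (lincomb phi c) (phi j) = c 0 j.
Proof.
rewrite (dot_lincomb (F := fun j : 'I_k => phi j)); last exact: basis_sqint.
  rewrite (bigD1 j) //= basis_dot eqxx mulr1 big1 ?addr0 // => i ij.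
  by rewrite basis_dot (inj_eq val_inj) (negbTE ij) mulr0.
by move=> i; exact: basis_sqint.
Qed.

(** Pythagoras: the error of the projection is orthogonal to S_k. *)
Lemma projection_le k (beta : 'rV[R]_k) g : sqint g ->
  (forall j : 'I_k, dot g (phi j) = beta 0 j) -> forall c : 'rV[R]_k,
  dot (lincomb phi beta \- g) (lincomb phi beta \- g) <=
  dot (lincomb phi c \- g) (lincomb phi c \- g).
Proof.
move=> sg gbeta c.
have sl (v : 'rV[R]_k) : sqint (lincomb phi v).
  by apply: sqint_lincombphi; exact: basis_sqint.
pose h1 := lincomb phi beta \- g.
have sh1 : sqint h1 by exact: sqintB.
have -> : lincomb phi c \- g = fun x => lincomb phi (c - beta) x + h1 x.
  apply/funext => x; rewrite /h1 /= addrA; congr (_ - _).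
  rewrite /lincomb -big_split /=; apply: eq_bigr => j _.
  by rewrite !mxE -mulrDl subrK.
rewrite dot_sqrD //.
have -> : dot (lincomb phi (c - beta)) h1 = 0.
  rewrite (dot_lincomb (F := fun j : 'I_k => phi j)) //; last first.
    by move=> j; exact: basis_sqint.
  apply: big1 => j _; rewrite dotC dotBl //; last exact: basis_sqint.
  by rewrite dot_lincomb_basis gbeta subrr mulr0.
by rewrite mulr0 addr0 lerDr dot_ge0.
Qed.

Section derivative_coefficients.
Variables (b : R -> R) (m p : nat) (Delta : 'M[R]_(m, m + p)).
Hypothesis db : forall x, derivable b x 1.
Hypothesis cb : continuous (derive1 b).
Hypothesis dphi : forall j, derivableI I (phi j).
Hypothesis bL : L2on I b.
Hypothesis b'L : L2on I (derive1 b \_ [set` I]).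
Hypothesis DeltaE : forall (j : 'I_m) x,
  deriveI I (phi j) x = \sum_(k < m + p) Delta j k * phi k x.
Hypothesis boundary : forall j, (j < m)%N -> exists v,
  value_at_inf I (b \* phi j) v /\ value_at_sup I (b \* phi j) v.
Variable theta : 'rV[R]_(m + p).
Hypothesis proj : forall t, linspan phi (m + p) t ->
  dotI I (b \- lincomb phi theta) t = 0.

Let sb : sqint (b \_ [set` I]). Proof. exact: L2on_sqint. Qed.

Lemma derive_sqint : sqint (derive1 b \_ [set` I]).
Proof.
have := L2on_sqint b'L; rewrite patch_off // => x xI.
by rewrite patchE memNset //; exact/negP.
Qed.

Lemma dot_patchl (g h : R -> R) : (forall x, x \notin I -> h x = 0) ->
  dot (g \_ [set` I]) h = \int[mu]_(x in [set` I]) (g x * h x).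
Proof.
move=> h0; rewrite [RHS]Rintegral_off => [|x xI]; last by rewrite h0 // mulr0.
apply: eq_Rintegral => x _; rewrite patchE; case: ifPn => // xI.
by rewrite h0 ?mulr0 //; apply: contraNN xI => /mem_set.
Qed.

Lemma projection_coef (k : 'I_(m + p)) : dot (b \_ [set` I]) (phi k) = theta 0 k.
Proof.
have lk : linspan phi (m + p) (phi k).
  exists (fun j => (j == k)%:R) => x; rewrite (bigD1 k) //= eqxx mul1r.
  by rewrite big1 ?addr0 // => j /negbTE ->; rewrite mul0r.
have := proj lk; rewrite dotIE; last exact: phi_off.
have sl : sqint (lincomb phi theta) by apply: sqint_lincombphi; exact: basis_sqint.
have -> : dot (b \- lincomb phi theta) (phi k) =
    dot ((b \_ [set` I]) \- lincomb phi theta) (phi k).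
  apply: eq_Rintegral => x _; have [xI|xI] := boolP (x \in I).
    by rewrite /= patchE mem_set.
  by rewrite phi_off // !mulr0.
rewrite dotBl //; last exact: basis_sqint.
by rewrite dot_lincomb_basis => /eqP; rewrite subr_eq0 => /eqP.
Qed.

Lemma derivative_coef (j : 'I_m) :
  dot (derive1 b \_ [set` I]) (phi j) = (- (theta *m Delta^T)) 0 j.
Proof.
have [c cI] := basis_open_itv.
have [v [vl vr]] := boundary (ltn_ord j).
have dE : deriveI I (phi j) = fun x => \sum_(k < m + p) Delta j k * phi k x.
  by apply/funext => x; exact: DeltaE.
have d_off x : x \notin I -> deriveI I (phi j) x = 0.
  by move=> xI; rewrite dE big1 // => k _; rewrite phi_off // mulr0.
have sd : sqint (deriveI I (phi j)).
  by rewrite dE; apply: (sqint_lincomb (F := fun k : 'I_(m + p) => phi k)) => k;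
    exact: basis_sqint.
have intI (g h : R -> R) : sqint (g \_ [set` I]) -> sqint h ->
    mu.-integrable [set` I] (EFin \o (fun x => g x * h x)).
  move=> sg sh.
  have : mu.-integrable [set` I] (EFin \o (fun x => (g \_ [set` I]) x * h x)).
    by apply: integrableS (sqint_integrable sg sh).
  by apply: eq_integrable => // x xI /=; rewrite patchE xI.
(* Continuity of phi_j' comes for free: it is a finite combination of differentiable functions. *)
have cd : {in open_itv I, continuous (deriveI I (phi j))}.
  move=> x xI; rewrite dE.
  apply: (@cvg_big R _ +%R 0 xpredT) => [|k _]; first exact: add_continuous.
  apply: cvgM; first exact: cvg_cst.
  apply/differentiable_continuous/derivable1_diffP.
  by have [] := derivableI_interior xI (@dphi k).
rewrite dot_patchl; last exact: phi_off.
rewrite (integration_by_parts_itv cI db cb (@dphi j) cd _ _ vl vr); last 2 first.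
- by apply: intI; [exact: derive_sqint|exact: basis_sqint].
- exact: intI.
rewrite -dot_patchl // dotC dE.
rewrite (@dot_suml R _ _ (fun (k : 'I_(m + p)) x => Delta j k * phi k x)) //;
  last by move=> k; apply: sqintZ; exact: basis_sqint.
rewrite !mxE; congr (- _); apply: eq_bigr => k _.
rewrite dotZl //; last exact: basis_sqint.
by rewrite dotC projection_coef mxE mulrC.
Qed.

End derivative_coefficients.
End projections.

(** * First and second moments of the noise *)

Section noise_moments.
Context d (T : measurableType d) (R : realType) (P : probability T R).
Variables (sigma : R) (n : nat) (eps : 'I_n -> {RV P >-> R}).
Hypothesis noise : iid_noise sigma eps.

(** The variance is the integral of a nonnegative function, so its finite value already gives square
    integrability. *)
Lemma noise_sqr k : P.-integrable setT (EFin \o (fun w => eps k w ^+ 2)) /\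
  \int[P]_w (eps k w * eps k w) = sigma ^+ 2.
Proof.
have [_ _ E0 V] := noise.
have : (\int[P]_w (eps k w ^+ 2)%:E = (sigma ^+ 2)%:E)%E.
  rewrite -(V k) /variance unlock E0 /= unlock.
  by apply: eq_integral => w _; rewrite fctE /= subr0 expr2.
move=> E2; have i2 : P.-integrable setT (EFin \o (fun w => eps k w ^+ 2)).
  apply: ge0_integrable => //; first exact: measurable_funX.
    by move=> w _; exact: sqr_ge0.
  by rewrite E2 ltry.
by split=> //; rewrite /Rintegral; under eq_integral do rewrite -expr2; rewrite E2.
Qed.

Lemma noise_integrable k : P.-integrable setT (EFin \o eps k).
Proof.
have [i2 _] := noise_sqr k.
have : P.-integrable setT (EFin \o (fun w => eps k w * cst 1 w)).
  apply: integrable_sqr_mul => //.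
  by under eq_fun do rewrite expr1n; apply: finite_measure_integrable_cst.
by under eq_fun do rewrite /= mulr1.
Qed.

Lemma noise_centered k : \int[P]_w eps k w = 0.
Proof. by have [_ _ E0 _] := noise; rewrite /Rintegral -expectation_def E0. Qed.

Lemma noise_uncorrelated k l :
  \int[P]_w (eps k w * eps l w) = if k == l then sigma ^+ 2 else 0.
Proof.
case: eqVneq => [<-|kl]; first by case: (noise_sqr k).
have [ind _ _ _] := noise.
rewrite indep_RintegralM ?noise_centered ?mulr0 //; try exact: noise_integrable.
move=> A B mA mB.
have := ind [set k; l]%SET (fun i => if i == k then A else B).
rewrite big_setU1 ?inE //= big_set1 eqxx eq_sym (negbTE kl) => <-; last first.
  by move=> i; case: ifP.
congr (P _); apply/seteqP; split => [w [Aw Bw] i|w h].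
  by rewrite /= !inE => /orP[] /eqP ->; rewrite ?eqxx // eq_sym (negbTE kl).
split; first by have := h k; rewrite /= eqxx; apply; rewrite !inE eqxx.
by have := h l; rewrite /= eq_sym (negbTE kl); apply; rewrite !inE eqxx orbT.
Qed.

End noise_moments.

(** * The risk bound *)

Theorem proposition3p9 (R : realType) (d : measure_display)
    (T : measurableType d) (P : probability T R)
    (n m p : nat) (n_ge2 : (2 <= n)%N) (m_gt0 : (0 < m)%N)
    (X eps : 'I_n -> {RV P >-> R}) (f : R -> R) (sigma : R) (b : R -> R)
    (I : interval R) (phi : nat -> R -> R)
    (bproj : R -> R) (Delta : 'M[R]_(m, m + p)) (c81 : R) :
  let X1 : T -> R := X (Ordinal (ltnW n_ge2)) in
  let Y1 : T -> R := fun w => response b X eps w (Ordinal (ltnW n_ge2)) 0 in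
  let b' : R -> R := derive1 b \_ [set` I] in
  let D := Deltaf2 I phi f Delta in
  (forall x, derivable b x 1) -> continuous (derive1 b) ->
  iid_with_density f X ->
  iid_noise sigma eps ->
  independent_families P (fun i => X i : T -> R) (fun i => eps i : T -> R) ->
  hilbert_basis I phi ->
  (forall j, derivableI I (phi j)) ->
  (forall j x, x \notin I -> phi j x = 0) ->
  L2on I b -> L2on I b' ->
  orthogonal_projection I phi (m + p) b bproj ->
  (forall (j : 'I_m) x,
     deriveI I (phi j) x = \sum_(k < m + p) Delta j k * phi k x) ->
  deviation_constant I phi f c81 ->
  has_ubound [set f x | x in [set` I]] ->
  (forall j, (j < m)%N -> linspan phi (j.+1 + p) (deriveI I (phi j))) ->
  (forall j, (j < m)%N -> exists v,
     value_at_inf I (b \* phi j) v /\ value_at_sup I (b \* phi j) v) ->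
  (frakL I phi (m + p) < +oo)%E ->
  stability I phi (Psi I phi f (m + p)) (frakc R / 2 * (n%:R / ln n%:R)) ->
  ('E_P[fun w => (b' (X1 w) ^+ 4)%R] < +oo)%E ->
  ('E_P[fun w => (Y1 w ^+ 4)%R] < +oo)%E ->
  ('E_P[fun w => sqnormn (fun i => X i w)
                   (tildeb I phi b Delta X eps w \- b')%R] <=
   (2 * supI I f * inf [set sqnormI I (t \- b') | t in linspan phi m]
    + 6 * opnorm D ^+ 2 * sqnormf I f (b \- bproj)
    + 2 * sigma ^+ 2 / n%:R * sqfrobenius D
    + (2 * frakc R * n%:R / ln n%:R * opnorm Delta ^+ 2
         * Num.sqrt (fine 'E_P[fun w => (Y1 w ^+ 4)%R])
       + 3 * Num.sqrt (fine 'E_P[fun w => (b' (X1 w) ^+ 4)%R]))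
      * (Num.sqrt c81 / n%:R ^+ 4))%:E)%E.
Proof.
move=> X1 Y1 b' D db cb iX ieps indep basis dphi phi_off bL b'L [bspan bort]
  DeltaE [c0 dev] fub _ boundary Loo stab Eb4 EY4.
have n_gt0 : (0 < n)%N := ltnW n_ge2.
have N_gt0 : (0 < m + p)%N by rewrite addn_gt0 m_gt0.
have [[mf f0] _ law] := iX.
have [L LE L_gt0] := frakL_pos basis phi_off N_gt0 Loo.
have Pu := stability_unitmx LE L_gt0 stab.
(* The threshold of [Lambda], twice the one in [stab]. *)
pose Bd : R := frakc R * n%:R / ln n%:R.
have phi_sq j : sqint (phi j) := basis_sqint basis phi_off j.
have [theta thetaE] := linspanP bspan.
have sb : sqint (b \_ [set` I]) := L2on_sqint bL.
have sb' : sqint b' := derive_sqint b'L.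
have b'_off x : x \notin I -> b' x = 0.
  by move=> xI; rewrite /b' patchE memNset //; exact/negP.
have lsq_ k (c : 'rV[R]_k) : sqint (lincomb phi c) := sqint_lincombphi phi_sq c.
pose beta := - (theta *m Delta^T).
have bcoef (j : 'I_m) : dot b' (phi j) = beta 0 j.
  apply: (derivative_coef basis phi_off db cb dphi bL b'L DeltaE boundary).
  by rewrite -thetaE.
pose q : R -> R := lincomb phi beta \- b'.
pose r : R -> R := (b \_ [set` I]) \- lincomb phi theta.
have sq : sqint q by exact: sqintB.
have sr : sqint r by exact: sqintB.
have q_off x : x \notin I -> q x = 0.
  by move=> xI; rewrite /q /= (lincomb_off phi_off _ xI) b'_off // subrr.
have r_off x : x \notin I -> r x = 0.
  move=> xI; rewrite /r /= (lincomb_off phi_off _ xI) patchE memNset ?subrr //; exact/negP.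
have supf0 : 0 <= supI I f.
  have [c /open_itv_sub cI] := basis_open_itv basis phi_off.
  by apply: le_trans (f0 c) (le_supI fub cI).
(* [beta] gives the orthogonal projection of b', whose Lebesgue distance to b' is a lower bound of
   the set under the infimum. *)
have qle : sqnormf I f q <=
    supI I f * inf [set sqnormI I (t \- b') | t in linspan phi m].
  apply: le_trans (sqnormf_le mf f0 fub q_off sq) _; apply: ler_wpM2l => //.
  apply: lb_le_inf; first by exists (sqnormI I (lincomb phi (0 : 'rV[R]_m) \- b'));
    exists (lincomb phi (0 : 'rV[R]_m)) => //; exact: linspan_lincomb.
  move=> _ [t /linspanP[c ->] <-]; rewrite /sqnormI !dotIE //.
    exact: (projection_le basis phi_off sb' bcoef c).
  by move=> x xI /=; rewrite (lincomb_off phi_off _ xI) b'_off // subrr.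
have rE : sqnormf I f r = sqnormf I f (b \- bproj).
  rewrite thetaE /sqnormf /dotf; apply: eq_Rintegral => x xI.
  by rewrite /r /= patchE xI.
have [POm PLam] := dev d T P n (m + p)%N X n_ge2 N_gt0 iX stab.
pose x (w : T) : 'I_n -> R := fun i => X i w.
have mX i : measurable_fun setT (X i : T -> R) by exact: measurable_funP.
have meps i : measurable_fun setT (eps i : T -> R) by exact: measurable_funP.
set Om := Omega I phi f (m + p) X in POm.
set La := Lambda I phi (m + p) X in PLam.
have mOm : measurable Om.
  exact: (borel_Omega mf f0 fub phi_sq phi_off Pu (x := fun i => X i)).
have mLa : measurable La.
  exact: (borel_Lambda Bd phi_sq LE L_gt0 (x := fun i => X i)).
pose U i w := signal_stat I phi f Delta Bd q r i (x w).
pose a i k w := noise_stat I phi f Delta Bd i k (x w).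
have bU (i : 'I_n) : borel_stat (signal_stat I phi f Delta Bd q r i).
  exact: (borel_signal_stat Delta Bd mf f0 fub phi_sq phi_off LE L_gt0 Pu
    sq.1 sr.1).
have ba (i k : 'I_n) : borel_stat (noise_stat I phi f Delta Bd i k).
  exact: (borel_noise_stat Delta Bd mf f0 fub phi_sq phi_off LE L_gt0 Pu).
have mU i : measurable_fun setT (U i) by exact: (@bU i d T (fun i => X i : T -> R) mX).
have ma i k : measurable_fun setT (a i k) by exact: (@ba i k d T (fun i => X i : T -> R) mX).
have Esq (g : R -> R) i : (forall y, y \notin I -> g y = 0) -> sqint g ->
    P.-integrable setT (EFin \o (fun w => g (X i w) ^+ 2)) /\
    \int[P]_w (g (X i w) ^+ 2) = sqnormf I f g.
  by move=> g0 sg; apply: (expectation_sqr mf f0 fub (law i)).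
pose K w : R := 2 * (\sum_i q (X i w) ^+ 2) +
  6 * opnorm D ^+ 2 * (\sum_i r (X i w) ^+ 2).
have UK w : \sum_i U i w ^+ 2 <= K w.
  exact: (sum_signal_stat_le Delta Bd n_gt0 mf f0 fub phi_sq phi_off LE L_gt0 Pu).
have iq : P.-integrable setT (EFin \o (fun w => \sum_i q (X i w) ^+ 2)).
  by apply: integrable_sumr => // i; case: (Esq q i).
have ir : P.-integrable setT (EFin \o (fun w => \sum_i r (X i w) ^+ 2)).
  by apply: integrable_sumr => // i; case: (Esq r i).
have iK : P.-integrable setT (EFin \o K).
  by apply: integrable_addr => //; exact: integrable_mulr_cst.
have EK : \int[P]_w K w = n%:R * (2 * sqnormf I f q + 6 * opnorm D ^+ 2 * sqnormf I f r).
  have sumE (g : R -> R) : (forall y, y \notin I -> g y = 0) -> sqint g ->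
      \int[P]_w (\sum_i g (X i w) ^+ 2) = n%:R * sqnormf I f g.
    move=> g0 sg; rewrite Rintegral_sum //; last by move=> i; case: (Esq g i).
    rewrite (eq_bigr (fun=> sqnormf I f g)) => [|i _]; last by case: (Esq g i).
    by rewrite sumr_const card_ord mulr_natl.
  rewrite /K RintegralD //; try exact: integrable_mulr_cst.
  rewrite !RintegralZl // !sumE //; ring.
have iU i : P.-integrable setT (EFin \o (fun w => U i w ^+ 2)).
  apply: (integrable_le _ _ iK) => //; first exact: measurable_funX.
  move=> w _; rewrite ger0_norm ?sqr_ge0 //; apply: le_trans (UK w).
  by rewrite (bigD1 i) //= lerDl; apply: sumr_ge0 => j _; exact: sqr_ge0.
have EU : \sum_i \int[P]_w (U i w ^+ 2) <=
    n%:R * (2 * sqnormf I f q + 6 * opnorm D ^+ 2 * sqnormf I f r).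
  rewrite -EK -Rintegral_sum //; apply: le_Rintegral => //.
  exact: integrable_sumr.
have aC i k w : `|a i k w| <= Num.sqrt (Bd * opnorm Delta ^+ 2).
  exact: (noise_stat_le f Delta Bd n_gt0 phi_off LE L_gt0).
have ia i k : P.-integrable setT (EFin \o (fun w => a i k w ^+ 2)).
  apply: (@integrable_le _ _ _ _ _ _ _ (cst (Num.sqrt (Bd * opnorm Delta ^+ 2) ^+ 2))) => //.
  - exact: measurable_funX.
  - exact: finite_measure_integrable_cst.
  - move=> w _; rewrite /= normrX ler_sqr ?nnegrE ?sqrtr_ge0 //; exact: aC.
have Ea : \sum_i \int[P]_w (\sum_k a i k w ^+ 2) <= 2 * sqfrobenius D.
  have dir_off l y : y \notin I -> noise_dir I phi f Delta l y = 0.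
    by move=> yI; exact: (lincomb_off phi_off).
  have dir_sq l : sqint (noise_dir I phi f Delta l) by exact: lsq_.
  have idir l i : P.-integrable setT
      (EFin \o (fun w => noise_dir I phi f Delta l (X i w) ^+ 2)).
    exact: (Esq _ i (@dir_off l) (dir_sq l)).1.
  have iA i : P.-integrable setT (EFin \o (fun w => \sum_k a i k w ^+ 2)).
    exact: integrable_sumr.
  have idir2 : P.-integrable setT
      (EFin \o (fun w => \sum_l \sum_i noise_dir I phi f Delta l (X i w) ^+ 2)).
    by apply: integrable_sumr => // l; exact: integrable_sumr.
  rewrite -Rintegral_sum //.
  apply: (@le_trans _ _ (\int[P]_w (2 / n%:R * \sum_l \sum_i
      noise_dir I phi f Delta l (X i w) ^+ 2))).
    apply: le_Rintegral => //; first exact: integrable_sumr.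
      exact: integrable_mulr_cst.
    move=> w _.
    exact: (sum_noise_stat_le Delta Bd n_gt0 mf f0 fub phi_sq phi_off LE L_gt0 Pu).
  rewrite RintegralZl //.
  rewrite Rintegral_sum //; last by move=> l; exact: integrable_sumr.
  (* Each direction has the same expected square at all n points, which cancels the 1/n; this is E
     hatPsi_m = Psi_m. *)
  rewrite (eq_bigr (fun l => n%:R * sqnormf I f (noise_dir I phi f Delta l))); last first.
    move=> l _; rewrite Rintegral_sum //.
    rewrite (eq_bigr (fun=> sqnormf I f (noise_dir I phi f Delta l))) => [|i _].
      by rewrite sumr_const card_ord mulr_natl.
    exact: (Esq _ i (@dir_off l) (dir_sq l)).2.
  rewrite -mulr_sumr mulrA divfK; last by rewrite pnatr_eq0 -lt0n.
  have pPsi k : possemidef (Psi I phi f k) := possemidef_Psi mf f0 fub phi_sq phi_off k.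
  rewrite /D /Deltaf2 (sqfrobenius_rows Delta (pPsi _) (pPsi _)).
  rewrite le_eqVlt; apply/orP; left; apply/eqP; congr (_ * _).
  by apply: eq_bigr => l _; rewrite (sqnormf_lincomb mf f0 fub phi_sq phi_off).
have indepS (g h : ('I_n -> R) -> R) : borel_stat g -> borel_stat h ->
    indep2 P (fun w => g (x w)) (fun w => h (fun k => eps k w)).
  move=> bg bh A B mA mB; apply: indep.
    exact: (sigma_of_stat (X := fun i => X i : T -> R) bg).
  exact: (sigma_of_stat (X := fun i => eps i : T -> R) bh).
pose Z i w := (U i w + \sum_k a i k w * eps k w) ^+ 2.
have b1 k : borel_stat (fun e : 'I_n -> R => e k) by move=> ? ? y my; exact: my.
have bM (g h : ('I_n -> R) -> R) : borel_stat g -> borel_stat h ->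
    borel_stat (fun y => g y * h y).
  move=> bg bh d' T' y my; apply: measurable_funM; first exact: (@bg d' T' y my).
  exact: (@bh d' T' y my).
have ZE i : P.-integrable setT (EFin \o Z i) /\
    \int[P]_w Z i w = \int[P]_w (U i w ^+ 2) +
      sigma ^+ 2 * \int[P]_w (\sum_k a i k w ^+ 2).
  have ind1 k : indep2 P (fun w => U i w * a i k w) (eps k).
    exact: (indepS _ _ (bM _ _ (bU i) (ba i k)) (b1 k)).
  have ind2 k l : indep2 P (fun w => a i k w * a i l w) (fun w => eps k w * eps l w).
    exact: (indepS _ _ (bM _ _ (ba i k) (ba i l)) (bM _ _ (b1 k) (b1 l))).
  have ieps2 k := (noise_sqr ieps k).1.
  split.
    exact: (integrable_noise meps (noise_integrable ieps) ieps2 (mU i) (ma i)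
      (iU i) (aC i) ind1 ind2).
  exact: (Rintegral_noise meps (noise_integrable ieps) ieps2
    (noise_centered ieps) (noise_uncorrelated ieps) (mU i) (ma i)
    (iU i) (aC i) ind1 ind2).
have EZ : \sum_i \int[P]_w Z i w <=
    n%:R * (2 * sqnormf I f q + 6 * opnorm D ^+ 2 * sqnormf I f r) +
    2 * sigma ^+ 2 * sqfrobenius D.
  under eq_bigr do rewrite (ZE _).2.
  rewrite big_split /= lerD // -mulr_sumr.
  have -> : 2 * sigma ^+ 2 * sqfrobenius D = sigma ^+ 2 * (2 * sqfrobenius D) by ring.
  exact: (ler_wpM2l (sqr_ge0 _) Ea).
pose i0 := Ordinal (ltnW n_ge2).
pose M4 := fine 'E_P[fun w => (Y1 w ^+ 4)%R].
pose m4 := fine 'E_P[fun w => (b' (X1 w) ^+ 4)%R].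
have mb : measurable_fun setT b.
  apply: continuous_measurable_fun => y.
  by apply/differentiable_continuous/derivable1_diffP; exact: db.
pose Y i w := b (X i w) + eps i w.
have mY i : measurable_fun setT (Y i).
  by apply: measurable_funD => //; exact: measurableT_comp.
have EY i : P.-integrable setT (EFin \o (fun w => Y i w ^+ 4)) /\
    \int[P]_w (Y i w ^+ 4) = M4.
  (* All pairs (X_j, eps_j) have the same product law, so every response has the fourth moment of
     the first one. *)
  have pair_law j : (\int[P]_w (Y j w ^+ 4)%:E =
      \int[distribution P (X i0) \x distribution P (eps i0)]_z
        ((b z.1 + z.2) ^+ 4)%:E)%E.
    apply: (@integral_joint_law _ _ _ P (X j) (eps j) (mX j) (meps j)
      (distribution P (X i0)) (distribution P (eps i0)) _
      (fun z => ((b z.1 + z.2) ^+ 4)%:E)).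
    - move=> A B mA mB.
      have bj : borel_stat (fun e : 'I_n -> R => e j) := b1 j.
      have -> := indepS _ _ bj bj A B mA mB; congr (_ * _)%E.
        by have := law j A mA; rewrite -(law i0 A mA).
      by case: ieps => _ + _ _ => /(_ j i0 B mB).
    - apply/measurable_EFinP; apply: measurable_funX; apply: measurable_funD => //.
      exact: measurableT_comp.
    - by move=> z; rewrite lee_fin exprn_even_ge0.
  have E1 : ('E_P[fun w => (Y1 w ^+ 4)%R] = \int[P]_w (Y i w ^+ 4)%:E)%E.
    rewrite unlock pair_law -(pair_law i0); apply: eq_integral => w _.
    by rewrite /Y1 /response mxE.
  split; last by rewrite /M4 E1.
  apply: ge0_integrable => //; first exact: measurable_funX.
    by move=> w _; rewrite exprn_even_ge0.
  by rewrite -E1.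
have [mb' _] := sb'.
have Eb i : P.-integrable setT (EFin \o (fun w => b' (X i w) ^+ 4)) /\
    \int[P]_w (b' (X i w) ^+ 4) = m4.
  have blaw j := integral_density (h := fun y => (b' y ^+ 4)%:E) mf f0 (law j).
  have E1 : ('E_P[fun w => (b' (X1 w) ^+ 4)%R] = \int[P]_w (b' (X i w) ^+ 4)%:E)%E.
    rewrite unlock !blaw //; try by apply/measurable_EFinP; exact: measurable_funX.
      by move=> y; rewrite lee_fin exprn_even_ge0.
    by move=> y; rewrite lee_fin exprn_even_ge0.
  split; last by rewrite /m4 E1.
  apply: ge0_integrable => //.
  - by apply: measurable_funX; exact: measurableT_comp.
  - by move=> w _; rewrite exprn_even_ge0.
  - by rewrite -E1.
have mbX i : measurable_fun setT (fun w => b' (X i w)) by exact: measurableT_comp.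
have csY i := cauchy_schwarz_deviation (measurableC mOm) n_gt0 c0 POm (mY i) (EY i).1.
have csbO i := cauchy_schwarz_deviation (measurableC mOm) n_gt0 c0 POm (mbX i) (Eb i).1.
have csbL i := cauchy_schwarz_deviation (measurableC mLa) n_gt0 c0 PLam (mbX i) (Eb i).1.
pose C := Bd * opnorm Delta ^+ 2.
(* Majorant with one group of terms per event: [Z] on the good event, the middle terms off [Omega],
   the last one off [Lambda]. *)
pose V i w : R := Z i w + (2 * C * (\1_(~` Om) w * Y i w ^+ 2) +
   2 * (\1_(~` Om) w * b' (X i w) ^+ 2)) + \1_(~` La) w * b' (X i w) ^+ 2.
have Bd_ge0 : 0 <= Bd.
  have := (stability_psd _ _ LE L_gt0).1 stab => -[h _].
  have := le_trans (ltW L_gt0) h; rewrite /Bd -mulrA; lra.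
have C_ge0 : 0 <= C by rewrite mulr_ge0 // sqr_ge0.
have I0 (A : set T) w : 0 <= (\1_A w : R) by rewrite indicE.
have Zge0 i w : 0 <= Z i w by exact: sqr_ge0.
have tY i w : 0 <= 2 * C * (\1_(~` Om) w * Y i w ^+ 2).
  by apply: mulr_ge0; [exact: mulr_ge0|apply: mulr_ge0; [exact: I0|exact: sqr_ge0]].
have tb (A : set T) i w : 0 <= \1_A w * b' (X i w) ^+ 2.
  by apply: mulr_ge0; [exact: I0|exact: sqr_ge0].
have tb2 (A : set T) i w : 0 <= 2 * (\1_A w * b' (X i w) ^+ 2).
  by apply: mulr_ge0 => //; exact: tb.
have pw w : sqnormn (x w) (tildeb I phi b Delta X eps w \- b') <=
    n%:R^-1 * \sum_i V i w.
  rewrite /sqnormn ler_wpM2l ?invr_ge0 //.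
  have [wL|wL] := boolP (w \in La); last first.
    apply: ler_sum => i _.
    rewrite /tildeb [\1_(Lambda _ _ _ _) w]indicE -/La (negbTE wL) /= mulr0 sub0r sqrrN.
    rewrite /V [\1_(~` La) w]indicE in_setC wL mul1r lerDr.
    by rewrite addr_ge0 // addr_ge0.
  have Lx : Lambda_at I phi m p Bd (x w) by exact: set_mem wL.
  have tE i : (tildeb I phi b Delta X eps w \- b') (x w i) =
      hatb phi Delta (x w) (\col_k (b (x w k) + eps k w)) (x w i) - b' (x w i).
    by rewrite /= /tildeb [\1_(Lambda _ _ _ _) w]indicE -/La wL mulr1.
  under eq_bigr do rewrite tE.
  have [wO|wO] := boolP (w \in Om).
    apply: ler_sum => i _.
    have Gx : x w \in Good I phi f m p Bd by apply: mem_set; split => //; exact: set_mem wO.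
    rewrite (hatb_decomp Delta phi_off LE L_gt0 b (fun k => eps k w) theta i Lx).
    have -> : lincomb phi (- (theta *m Delta^T)) (x w i)
        - (\row_k ((b \_ [set` I]) (x w k) - lincomb phi theta (x w k)) *m
           smoother phi Delta (x w)) 0 i
        - \sum_k eps k w * smoother phi Delta (x w) k i - b' (x w i) =
        U i w + \sum_k a i k w * eps k w.
      rewrite /U /signal_stat /a /noise_stat indicE Gx mul1r.
      under [in RHS]eq_bigr do rewrite mul1r mulNr mulrC.
      by rewrite sumrN /q /= -/beta addrAC [X in X - _ = _]addrAC.
    rewrite /V -/(Z i w) -addrA lerDl.
    by rewrite addr_ge0 // addr_ge0.
  (* On [Lambda] but off [Omega] the bound holds only after summation over the sample, since
     [smoother_le] controls the whole vector. *)
  apply: (@le_trans _ _ (2 * (C * \sum_i Y i w ^+ 2) + 2 * \sum_i b' (x w i) ^+ 2)).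
    have h := smoother_le Delta n_gt0 phi_off LE L_gt0
      (\col_k (b (x w k) + eps k w))^T Lx.
    apply: (@le_trans _ _ (2 * sqn ((\col_k (b (x w k) + eps k w))^T *m
        smoother phi Delta (x w)) + 2 * \sum_i b' (x w i) ^+ 2)).
      rewrite sqnE !mulr_sumr -big_split /=; apply: ler_sum => i _.
      rewrite hatb_smoother; set u := (_ *m _) 0 i; set v := b' _.
      have := sqr_ge0 (u - v); nra.
    rewrite lerD2r ler_wpM2l //; apply: le_trans h _; rewrite -/C ler_wpM2l //.
    by rewrite sqnE; apply: ler_sum => i _; rewrite !mxE.
  rewrite !mulr_sumr -big_split /=; apply: ler_sum => i _.
  rewrite /V [\1_(~` Om) w]indicE in_setC wO !mul1r mulrA.
  apply: (@le_trans _ _ (Z i w + (2 * C * Y i w ^+ 2 + 2 * b' (x w i) ^+ 2))).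
    by rewrite lerDr.
  by rewrite lerDl.
have iV1 i : P.-integrable setT (EFin \o (fun w => 2 * C * (\1_(~` Om) w * Y i w ^+ 2))).
  by apply: integrable_mulr_cst => //; exact: (csY i).1.
have iV2 i : P.-integrable setT (EFin \o (fun w => 2 * (\1_(~` Om) w * b' (X i w) ^+ 2))).
  by apply: integrable_mulr_cst => //; exact: (csbO i).1.
have iV i : P.-integrable setT (EFin \o V i).
  apply: integrable_addr => //; last exact: (csbL i).1.
  apply: integrable_addr => //; first exact: (ZE i).1.
  exact: integrable_addr.
have EV i : \int[P]_w V i w <= \int[P]_w Z i w +
    (2 * C * Num.sqrt M4 + 3 * Num.sqrt m4) * (Num.sqrt c81 / n%:R ^+ 4).
  rewrite /V RintegralD //; [|apply: integrable_addr => //; [exact: (ZE i).1|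
    exact: integrable_addr]|exact: (csbL i).1].
  rewrite RintegralD //; [|exact: (ZE i).1|exact: integrable_addr].
  rewrite RintegralD // RintegralZl //; last exact: (csY i).1.
  rewrite RintegralZl //; last exact: (csbO i).1.
  have := (csY i).2; have := (csbO i).2; have := (csbL i).2.
  rewrite (EY i).2 !(Eb i).2.
  set e1 := \int[P]_w _; set e2 := \int[P]_w _; set e3 := \int[P]_w _.
  move=> h1 h2 h3; have := ler_wpM2l C_ge0 h3.
  set k := _ / _ in h1 h2 h3 *.
  lra.
have mhat i : measurable_fun setT (fun w => tildeb I phi b Delta X eps w (X i w)).
  apply: measurable_funM; last exact: measurable_indic.
  under eq_fun do rewrite (hatb_smoother phi Delta (x _)).
  apply: measurable_funN; apply: measurable_mulmx => [u k|k l].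
    by under eq_fun do rewrite !mxE; exact: mY.
  exact: (@borel_smoother R phi n m p Delta phi_sq k l d T (fun i => X i : T -> R) mX).
have iVn : P.-integrable setT (EFin \o (fun w => n%:R^-1 * \sum_i V i w)).
  by apply: integrable_mulr_cst => //; exact: integrable_sumr.
have expE (h : T -> R) : ('E_P[h] = \int[P]_w (h w)%:E)%E by rewrite unlock.
rewrite [X in (X <= _)%E]expE.
apply: (@le_trans _ _ (\int[P]_w (n%:R^-1 * \sum_i V i w)%:E)%E).
  apply: ge0_le_integral => //.
  - move=> w _; rewrite lee_fin mulr_ge0 ?invr_ge0 //.
    by apply: sumr_ge0 => i _; exact: sqr_ge0.
  - apply/measurable_EFinP; apply: measurable_funM => //.
    apply: measurable_sum => i; apply: measurable_funX.
    exact: measurable_funB.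
  - exact: measurable_int iVn.
  - by move=> w _; rewrite lee_fin; exact: pw.
rewrite -EFin_Rintegral // lee_fin RintegralZl //; last exact: integrable_sumr.
rewrite Rintegral_sum // mulrC ler_pdivrMr ?ltr0n //.
apply: le_trans (ler_sum _ (fun i _ => EV i)) _.
rewrite big_split /= sumr_const card_ord -[X in _ + X <= _]mulr_natr.
apply: le_trans (lerD EZ (lexx _)) _.
rewrite -rE.
have nq := ler_wpM2l (ler0n R n) qle.
rewrite -/M4 -/m4.
have -> : 2 * frakc R * n%:R / ln n%:R * opnorm Delta ^+ 2 = 2 * C.
  by rewrite /C /Bd !mulrA.
set k := _ / _ ^+ 4.
have -> : 2 * sigma ^+ 2 / n%:R * sqfrobenius D =
    2 * sigma ^+ 2 * sqfrobenius D / n%:R by rewrite mulrAC.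
(* Naming the quotient by n and recording its product with n leaves an inequality that is linear in
   the named terms. *)
have nn : n%:R != 0 :> R by rewrite pnatr_eq0 -lt0n.
have := divfK nn (2 * sigma ^+ 2 * sqfrobenius D).
set s := _ / n%:R; move=> sE; lra.
Qed.
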